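(* Let $K$ be a local field with ring of integers $\mathcal{O}_K$, and let $\phi(z)\in K(z)$ be a rational map of degree $2$. Then $\phi$ has potential good reduction if and only if $[\phi]\in M_2(\mathcal{O}_K)$.
   Context: Here a local field $K$ is a field complete with respect to a normalized discrete valuation $v:K^*\twoheadrightarrow\mathbb{Z}$; $\mathcal{O}_K=\{\alpha\in K: v(\alpha)\ge 0\}$, with maximal ideal $\mathfrak{p}=\{\alpha: v(\alpha)\geq 1\}$ and residue field $k=\mathcal{O}_K/\mathfrak{p}$. The valuation extends uniquely to every finite extension of $K$. Conjugation: for $f\in\mathrm{PGL}_2$, $\phi^f=f^{-1}\circ\phi\circ f$. Good reduction: write $\phi=F/G$ with coefficients of $F,G$ in $\mathcal{O}_K$ and at least one coefficient a unit; the reduction $\tilde\phi$ is the rational map over $k$ obtained by reducing coefficients modulo $\mathfrak{p}$ (and cancelling common factors). $\phi$ has good reduction if $\deg\tilde\phi=\deg\phi$; equivalently, the resultant of the degree-$d$ homogenizations of $F,G$ (where $d=\deg\phi$) is a unit. $\phi$ has potential good reduction if there is $f\in\mathrm{PGL}_2(\bar K)$ such that $\phi^f$ is defined over, and has good reduction over, a finite extension of $K$. Multipliers: the multiplier of $\phi$ at a finite fixed point $\alpha$ is $\phi'(\alpha)$ (at $\infty$, it is computed after a change of coordinates moving $\infty$ to a finite point). A degree $2$ map has three fixed points in $\mathbb{P}^1(\bar K)$ counted with multiplicity, with multipliers $\lambda_1,\lambda_2,\lambda_3$. Let $\sigma_1=\lambda_1+\lambda_2+\lambda_3$ and $\sigma_2=\lambda_1\lambda_2+\lambda_1\lambda_3+\lambda_2\lambda_3$;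 these lie in $K$. Moduli space: $M_2=\mathrm{Rat}_2/\mathrm{PGL}_2$ is the moduli space of degree $2$ rational maps on $\mathbb{P}^1$ modulo conjugation; $M_2\cong\mathbb{A}^2$ with coordinates $(\sigma_1,\sigma_2)$. $[\phi]$ is the point of $M_2$ given by $\phi$, and $[\phi]\in M_2(\mathcal{O}_K)$ ($[\phi]$ is an integral point) means $\sigma_1,\sigma_2\in\mathcal{O}_K$. *)

(* Defs.v *)
From HB Require Import structures.
From mathcomp Require Import all_boot all_order all_algebra all_field.

Set Implicit Arguments.
Unset Strict Implicit.
Unset Printing Implicit Defensive.

Import Order.TTheory GRing.Theory Num.Theory.
Local Open Scope ring_scope.

(* The convention v(0) = +oo is encoded by leaving the value of v at 0
   unconstrained and comparing valuations through vge below. *)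
Record dvaluation (K : fieldType) := DValuation {
  dval :> K -> int;
  dvalM : forall x y, x != 0 -> y != 0 -> dval (x * y) = dval x + dval y;
  dvalD : forall x y, x != 0 -> y != 0 -> x + y != 0 ->
            Num.min (dval x) (dval y) <= dval (x + y);
  dval_onto : forall n : int, exists2 x, x != 0 & dval x = n }.

Definition vge (K : fieldType) (v : dvaluation K) (n : int) (x : K) : bool :=
  (x == 0) || (n <= v x).

Definition complete_dvaluation (K : fieldType) (v : dvaluation K) : Prop :=
  forall u : nat -> K,
    (forall N : int, exists n0 : nat, forall m n : nat,
        (n0 <= m)%N -> (n0 <= n)%N -> vge v N (u m - u n)) ->
    exists l : K, forall N : int, exists n0 : nat, forall n : nat,
        (n0 <= n)%N -> vge v N (u n - l).

(* The factor e accounts for both v and w being normalized: it is the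
   ramification index. *)
Definition dval_extends (K : fieldType) (L : fieldExtType K)
    (v : dvaluation K) (w : dvaluation L) : Prop :=
  exists2 e : nat, (0 < e)%N &
    forall x : K, x != 0 -> w (x%:A : L) = v x *+ e.

Section ValuationRing.
Variables (K : fieldType) (v : dvaluation K).

Lemma vge0 n : vge v n 0. Proof. by rewrite /vge eqxx. Qed.

Lemma vgeD n x y : vge v n x -> vge v n y -> vge v n (x + y).
Proof.
rewrite /vge; have [->|x0] := eqVneq x 0; first by rewrite add0r.
have [->|y0 /= nx ny] := eqVneq y 0; first by rewrite addr0 (negPf x0).
have [//|s0 /=] := eqVneq (x + y) 0.
by apply: le_trans (dvalD v x0 y0 s0); rewrite le_min nx ny.
Qed.

Lemma vgeM m n x y : vge v m x -> vge v n y -> vge v (m + n) (x * y).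
Proof.
rewrite /vge mulf_eq0; have [//|x0] := eqVneq x 0.
have [//|y0 /= mx ny] := eqVneq y 0.
by rewrite dvalM // lerD.
Qed.

Lemma dval1 : v 1 = 0.
Proof.
have := dvalM v (oner_neq0 K) (oner_neq0 K); rewrite mulr1.
by rewrite -[LHS]addr0 => /addrI/esym.
Qed.

Lemma dvalV x : x != 0 -> v x^-1 = - v x.
Proof.
move=> x0; apply/eqP; rewrite -addr_eq0 -dvalM ?invr_eq0 //.
by rewrite mulVf // dval1.
Qed.

Lemma dvalN x : x != 0 -> v (- x) = v x.
Proof.
move=> x0; have N0 : (-1 : K) != 0 by rewrite oppr_eq0 oner_neq0.
rewrite -mulN1r dvalM //; suff -> : v (-1) = 0 by rewrite add0r.
have := dvalM v N0 N0; rewrite mulrNN mulr1 dval1.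
by move/esym/eqP; rewrite -mulr2n mulrn_eq0 /= => /eqP.
Qed.

Lemma vgeN n x : vge v n (- x) = vge v n x.
Proof.
by rewrite /vge oppr_eq0; have [//|x0] := eqVneq x 0; rewrite /= dvalN.
Qed.

Lemma vge0_subring : subring_closed (vge v 0).
Proof.
split=> [|x y|x y]; rewrite ?inE.
- by rewrite -topredE /= /vge dval1 lexx orbT.
- by rewrite -!topredE /= => Ox Oy; rewrite vgeD ?vgeN.
- by rewrite -!topredE /= => Ox Oy; rewrite -[0]addr0 vgeM.
Qed.

HB.instance Definition _ :=
  GRing.isSubringClosed.Build K (vge v 0) vge0_subring.

Record valring := ValRing { valring_val :> K; _ : vge v 0 valring_val }.

HB.instance Definition _ := [isSub for valring_val].
HB.instance Definition _ := [Choice of valring by <:].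
HB.instance Definition _ := [SubChoice_isSubComNzRing of valring by <:].

Definition maxideal : {pred valring} := fun x => vge v 1 (val x).

Lemma maxideal_idealr : idealr_closed maxideal.
Proof.
split.
- by rewrite -topredE /= /maxideal rmorph0 vge0.
- by rewrite -topredE /= /maxideal rmorph1 /vge dval1 oner_eq0.
move=> a x y; rewrite -!topredE /= /maxideal => mx my.
rewrite rmorphD rmorphM; apply: vgeD => //.
by rewrite -[1]add0r; apply: vgeM => //; case: (a).
Qed.

HB.instance Definition _ :=
  isIdealr.Build valring maxideal maxideal_idealr.

Definition residue := {ideal_quot maxideal}.

HB.instance Definition _ := GRing.ComNzRing.on residue.

Definition residue_map (x : valring) : residue := \pi_{ideal_quot maxideal}%qT x.

HB.instance Definition _ := GRing.RMorphism.copy residue_map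
  (\pi_{ideal_quot maxideal}%qT : valring -> {ideal_quot maxideal}).

Lemma residue_map_eq0 x : (residue_map x == 0) = vge v 1 (val x).
Proof.
rewrite -(rmorph0 residue_map) /residue_map -Quotient.idealrBE subr0.
by rewrite -topredE.
Qed.

Lemma residue_map_surj (r : residue) : exists x, residue_map x = r.
Proof. by exists (repr r); rewrite /residue_map reprK. Qed.

Definition residue_inv (r : residue) : residue :=
  if r == 0 then 0 else
  residue_map (insubd (0 : valring) (val (repr r : valring))^-1).

Lemma residue_mulVf (r : residue) : r != 0 -> residue_inv r * r = 1.
Proof.
move=> r0; rewrite /residue_inv (negPf r0).
set x : valring := repr r.
have rE : residue_map x = r by rewrite /residue_map reprK.
rewrite -[X in _ * X]rE; move: r0; rewrite -[X in X != 0 -> _]rE.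
rewrite residue_map_eq0 negb_or -ltNge => /andP[x0].
rewrite -[1]add0r ltzD1 => vx.
have vx0 : v (val x) = 0.
  apply/eqP; rewrite eq_le vx /=.
  by have := valP x; rewrite /vge (negPf x0).
rewrite -rmorphM -(rmorph1 residue_map); congr residue_map.
apply: val_inj; rewrite rmorphM rmorph1 /=.
have -> : val (insubd (0 : valring) (val x)^-1) = (val x)^-1.
  by rewrite insubdK // -topredE /= /vge dvalV // vx0 oppr0 lexx orbT.
by rewrite mulVf.
Qed.

Lemma residue_inv0 : residue_inv 0 = 0.
Proof. by rewrite /residue_inv eqxx. Qed.

HB.instance Definition _ :=
  GRing.ComNzRing_isField.Build residue residue_mulVf residue_inv0.

End ValuationRing.

Notation ratfun K := {fraction {poly K}}.
Notation "x %:F" := (FracField.tofrac x) : ring_scope.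

Section RationalMaps.
Variable K : fieldType.
Implicit Types phi psi : ratfun K.

(* \n_(repr phi) / \d_(repr phi) need not be in lowest terms. *)
Definition rnum phi : {poly K} :=
  \n_(repr phi) %/ gcdp \n_(repr phi) \d_(repr phi).
Definition rden phi : {poly K} :=
  \d_(repr phi) %/ gcdp \n_(repr phi) \d_(repr phi).

Definition rdeg phi : nat := (maxn (size (rnum phi)) (size (rden phi))).-1.

Definition rmap (L : fieldType) (h : {rmorphism K -> L}) phi : ratfun L :=
  (map_poly h (rnum phi))%:F / (map_poly h (rden phi))%:F.

Definition reval (p : {poly K}) psi : ratfun K :=
  (map_poly (fun c : K => c%:P%:F) p).[psi].

(* phi o psi; meaningful when psi is nonconstant, as the constant map oo is
   not an element of K(z). *)
Definition rcomp phi psi : ratfun K := reval (rnum phi) psi / reval (rden phi) psi.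

Definition mobius (A : 'M[K]_2) : ratfun K :=
  (A 0 0 *: 'X + (A 0 1)%:P)%:F / (A 1 0 *: 'X + (A 1 1)%:P)%:F.

Definition rconj phi (A : 'M[K]_2) : ratfun K :=
  rcomp (rcomp (mobius (invmx A)) phi) (mobius A).

Definition rderiv_at phi (a : K) : K :=
  ((rnum phi)^`().[a] * (rden phi).[a] - (rnum phi).[a] * (rden phi)^`().[a])
    / (rden phi).[a] ^+ 2.

(* Points of P^1(K) are elements of option K, with None for oo; the change of
   coordinates used at oo is z |-> 1/z. *)
Definition multiplier phi (P : option K) : K :=
  if P is Some a then rderiv_at phi a
  else rderiv_at (rconj phi (\matrix_(i, j) (i != j)%:R)) 0.

End RationalMaps.

Section FixedPoints.
Variable K : closedFieldType.
Implicit Types phi : ratfun K.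

(* If phi = F/G has degree d, its fixed points are the zeros in P^1 of the
   form Y F(X,Y) - X G(X,Y) of degree d + 1, whose dehomogenization is
   F - X G: the multiplicity of oo is the drop in degree. *)
Definition fixpoly phi : {poly K} := rnum phi - 'X * rden phi.

Definition fixpoints phi : seq (option K) :=
  nseq (rdeg phi + 2 - size (fixpoly phi)) None
    ++ map Some (sval (closed_field_poly_normal (fixpoly phi))).

Definition multipliers phi : seq K := map (multiplier phi) (fixpoints phi).

(* Both are meant for maps of degree 2, which have three fixed points. *)
Definition sigma1 phi : K :=
  let l := multipliers phi in l`_0 + l`_1 + l`_2.
Definition sigma2 phi : K :=
  let l := multipliers phi in l`_0 * l`_1 + l`_0 * l`_2 + l`_1 * l`_2.

End FixedPoints.

(* If the reduction of G is 0, the reduced map is the constant oo, while the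
   quotient below is 0 by convention: both have degree 0. *)
Definition good_reduction (K : fieldType) (v : dvaluation K)
    (phi : ratfun K) : Prop :=
  exists F G : {poly valring v},
    [/\ G != 0,
        phi = (map_poly val F)%:F / (map_poly val G)%:F,
        exists2 c : valring v, (c \in (F : seq _)) || (c \in (G : seq _)) &
          (val c != 0) && (v (val c) == 0)
      & rdeg ((map_poly (@residue_map K v) F)%:F
                / (map_poly (@residue_map K v) G)%:F) = rdeg phi].

(* C is an algebraic closure of K, through iota. *)
Definition potential_good_reduction (K : fieldType) (v : dvaluation K)
    (C : closedFieldType) (iota : {rmorphism K -> C}) (phi : ratfun K) : Prop :=
  exists (L : fieldExtType K) (w : dvaluation L) (j : {rmorphism L -> C})
         (A : 'M[C]_2) (psi : ratfun L),
    [/\ dval_extends v w, (forall x : K, j x%:A = iota x), A \in unitmx,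
        rconj (rmap iota phi) A = rmap j psi
      & good_reduction w psi].

Definition integral_point (K : fieldType) (v : dvaluation K)
    (C : closedFieldType) (iota : {rmorphism K -> C}) (phi : ratfun K) : Prop :=
  exists s1 s2 : valring v,
    sigma1 (rmap iota phi) = iota (val s1) /\
    sigma2 (rmap iota phi) = iota (val s2).

(* Main.v *)
Require Import Defs.
From mathcomp Require Import all_boot all_order all_algebra all_field.
From mathcomp Require Import boolp classical_sets ring.

(** A rational map of degree 2 is, up to a scalar, a pair of binary quadratic
forms with nonzero resultant. The invariants sigma1 and sigma2 are quartic
forms in the six coefficients divided by the resultant ([sigma_qratfun]), and
conjugation multiplies both numerators and the resultant by one and the same
scalar ([qconj_sigma]). Both directions of the criterion are read off this
formula.

If a conjugate of phi over a finite extension of K has good reduction, it is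
given by a pair of forms with integral coefficients and unit resultant; this is
Gauss's lemma ([good_reduction_normal]). Its invariants are therefore integral
for the extended valuation. They are those of phi and lie in K, hence they are
integral for v.

Conversely, let sigma1 and sigma2 be integral, and choose a valuation subring B
of C lying over the ring of integers of K ([exists_valuation_subring]). Move a
fixed point of phi to oo. Its multiplier l is a root of the monic cubic
X^3 - sigma1 X^2 + sigma2 X - (sigma1 - 2), so it lies in B. There are two cases
([integral_normal_form]).
- If l is a unit of B, then phi is conjugate to (z^2 + t z + 1) / (l z), whose
  resultant is l^2, and t^2 = l^2 - (2 + sigma1) l + 4 puts t in B.
- Otherwise l <> 1, so oo is a simple fixed point and another fixed point can be
  placed at 0. Then phi is conjugate to (z^2 + m z) / (l z + 1). Here m is the
  multiplier at 0, so it lies in B as well, and the resultant 1 - l m is a unit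
  because l is not.

The coefficients of the normal form generate a finite extension L of K
([exists_finite_subextension]). The trace of B on L is a valuation ring, and
finiteness of L over K makes it the ring of a normalized discrete valuation
that extends v ([extend_dvaluation]). For this valuation the normal form has
good reduction. *)

Set Implicit Arguments.
Unset Strict Implicit.
Unset Printing Implicit Defensive.

Import Order.TTheory GRing.Theory Num.Theory.
Local Open Scope ring_scope.

(** * Pairs of binary quadratic forms *)

(** Both forms keep the formal degree 2, so that the leading coefficients may
vanish: the point oo and the finite points are then treated alike. *)
Record quadpair (R : Type) :=
  QuadPair { qa2 : R; qa1 : R; qa0 : R; qb2 : R; qb1 : R; qb0 : R }.

(** The resultant of the two forms, as a Bezout determinant. *)
Definition qres (R : comNzRingType) (q : quadpair R) : R :=
  let: QuadPair a2 a1 a0 b2 b1 b0 := q in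
  (a2 * b0 - a0 * b2) ^+ 2 - (a2 * b1 - a1 * b2) * (a1 * b0 - a0 * b1).

(** The numerator of sigma1 over the resultant, found by eliminating the fixed
points from the sum of their multipliers; [sigma_qratfun] justifies it. *)
Definition sigma1num (R : comNzRingType) (q : quadpair R) : R :=
  let: QuadPair a2 a1 a0 b2 b1 b0 := q in
  4 * a2^+2 * a0 * b1 + 2 * a2^+2 * b0^+2 - a2*a1^+2*b1 - 4*a2*a1*a0*b2
  + 4*a2*a0*b2*b0 - 2*a2*a0*b1^+2 + a1^+3*b2 - 2*a1^+2*b2*b0 + 4*a1*a0*b2*b1
  + 4*a1*b2*b0^+2 - a1*b1^+2*b0 - 6*a0^+2*b2^+2 - 4*a0*b2*b1*b0 + a0*b1^+3.

(** The numerator of sigma2, found in the same way. *)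
Definition sigma2num (R : comNzRingType) (q : quadpair R) : R :=
  let: QuadPair a2 a1 a0 b2 b1 b0 := q in
  4*a2^+3*a0 - a2^+2*a1^+2 + 2*a2^+2*a1*b0 - 4*a2^+2*a0*b1 + 10*a2*a1*a0*b2
  - a2*a1*b1*b0 - 4*a2*a0*b2*b0 + 5*a2*a0*b1^+2 + 2*a2*b1*b0^+2 - 2*a1^+3*b2
  + 5*a1^+2*b2*b0 - a1^+2*b1^+2 - 7*a1*a0*b2*b1 - 4*a1*b2*b0^+2 + 12*a0^+2*b2^+2
  + 10*a0*b2*b1*b0 - 2*a0*b1^+3 + 4*b2*b0^+3 - b1^+2*b0^+2.

(** The conjugate of F/G by the matrix of rows (a, b) and (c, d), with the
adjugate in place of the inverse: no division is needed, and the pair is only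
multiplied by the determinant. *)
Definition qsubst (R : comNzRingType) (q : quadpair R) (a b c d : R) :=
  let: QuadPair a2 a1 a0 b2 b1 b0 := q in
  let A2 := a2 * a^+2 + a1 * a * c + a0 * c^+2 in
  let A1 := a2 * a * b *+ 2 + a1 * (a * d + b * c) + a0 * c * d *+ 2 in
  let A0 := a2 * b^+2 + a1 * b * d + a0 * d^+2 in
  let B2 := b2 * a^+2 + b1 * a * c + b0 * c^+2 in
  let B1 := b2 * a * b *+ 2 + b1 * (a * d + b * c) + b0 * c * d *+ 2 in
  let B0 := b2 * b^+2 + b1 * b * d + b0 * d^+2 in
  QuadPair (d*A2 - b*B2) (d*A1 - b*B1) (d*A0 - b*B0)
           (a*B2 - c*A2) (a*B1 - c*A1) (a*B0 - c*A0).

(** Substituting in both forms contributes the fourth power of the determinant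
to the resultant, and mixing them by the adjugate its square. The two numerators
below have the same weight, which is why their quotients by the resultant are
invariants. *)
Lemma qres_subst (R : comNzRingType) (q : quadpair R) a b c d :
  qres (qsubst q a b c d) = (a * d - b * c) ^+ 6 * qres q.
Proof. by case: q => *; rewrite /qres /qsubst; ring. Qed.

Lemma sigma1num_subst (R : comNzRingType) (q : quadpair R) a b c d :
  sigma1num (qsubst q a b c d) = (a * d - b * c) ^+ 6 * sigma1num q.
Proof. by case: q => *; rewrite /sigma1num /qsubst; ring. Qed.

Lemma sigma2num_subst (R : comNzRingType) (q : quadpair R) a b c d :
  sigma2num (qsubst q a b c d) = (a * d - b * c) ^+ 6 * sigma2num q.
Proof. by case: q => *; rewrite /sigma2num /qsubst; ring. Qed.

(** * Fractions in lowest terms *)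

Section Fractions.
Variable K : fieldType.
Implicit Types (phi : ratfun K) (F G : {poly K}).

Lemma repr_frac phi : phi = (\n_(repr phi))%:F / (\d_(repr phi))%:F.
Proof.
set x := repr phi; have d0 : \d_x != 0 := denom_ratioP x.
have d0F : (\d_x)%:F != 0 :> ratfun K by rewrite tofrac_eq0.
apply: (canRL (mulfK d0F)); rewrite -[phi]reprK -/x.
unlock FracField.tofrac; rewrite -[LHS]FracField.pi_mul.
apply/eqmodP; rewrite /= FracField.equivfE /FracField.mulf.
by rewrite !numden_Ratio ?oner_neq0 ?mulf_neq0 ?mulr1 ?oner_neq0 //= mulrC.
Qed.

Lemma gcd_repr_neq0 phi : gcdp \n_(repr phi) \d_(repr phi) != 0.
Proof. by rewrite gcdp_eq0 negb_and denom_ratioP orbT. Qed.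

Lemma rdenK phi :
  rden phi * gcdp \n_(repr phi) \d_(repr phi) = \d_(repr phi).
Proof. by rewrite divpK ?dvdp_gcdr. Qed.

Lemma rnumK phi :
  rnum phi * gcdp \n_(repr phi) \d_(repr phi) = \n_(repr phi).
Proof. by rewrite divpK ?dvdp_gcdl. Qed.

Lemma rden_neq0 phi : rden phi != 0.
Proof. by have := denom_ratioP (repr phi); rewrite -rdenK mulf_eq0 => /norP[]. Qed.

Lemma coprime_rnum_rden phi : coprimep (rnum phi) (rden phi).
Proof. by apply: coprimep_div_gcd; rewrite denom_ratioP orbT. Qed.

Lemma frac_mulK F G H : H != 0 ->
  (F * H)%:F / (G * H)%:F = F%:F / G%:F :> ratfun K.
Proof.
by move=> H0; rewrite !tofracM -mulf_div divff ?mulr1 // tofrac_eq0.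
Qed.

Lemma rnum_rdenE phi : phi = (rnum phi)%:F / (rden phi)%:F.
Proof.
rewrite [LHS]repr_frac -(frac_mulK _ _ (gcd_repr_neq0 phi)).
by rewrite rnumK rdenK.
Qed.

Lemma frac_eq F G F' G' : G != 0 -> G' != 0 ->
  F%:F / G%:F = F'%:F / G'%:F :> ratfun K -> F * G' = F' * G.
Proof.
move=> G0 G'0 /eqP; rewrite eqr_div ?tofrac_eq0 //.
by rewrite -!tofracM tofrac_eq => /eqP.
Qed.

(** A fraction written arbitrarily differs from its lowest terms by a common
factor, since the reduced denominator divides G by Gauss's lemma. *)
Lemma rnum_rden_frac F G : G != 0 -> exists2 H, F = H * rnum (F%:F / G%:F)
   & G = H * rden (F%:F / G%:F).
Proof.
move=> G0; set phi := _ / _.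
have e : F * rden phi = rnum phi * G.
  by apply: frac_eq => //; rewrite ?rden_neq0 // -rnum_rdenE.
have dG : rden phi %| G.
  have : rden phi %| rnum phi * G by rewrite -e dvdp_mull.
  by rewrite Gauss_dvdpr // coprimep_sym coprime_rnum_rden.
exists (G %/ rden phi); last by rewrite divpK.
apply: (mulIf (rden_neq0 phi)); rewrite e mulrAC.
by rewrite divpK // mulrC.
Qed.

Lemma rnum_rden_coprime F G : G != 0 -> coprimep F G ->
  exists2 c, c != 0 & F = c *: rnum (F%:F / G%:F) /\ G = c *: rden (F%:F / G%:F).
Proof.
move=> G0 cFG; have [H eF eG] := rnum_rden_frac F G0.
have: H %= 1.
  by apply: (coprimepP _ _ cFG); [rewrite {1}eF|rewrite {1}eG]; rewrite dvdp_mulIl.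
rewrite -size_poly_eq1 => /size_poly1P[c c0 eH].
by exists c => //; split; rewrite -mul_polyC -eH.
Qed.

End Fractions.

(** * Rational maps of degree 2 and their resultant *)

Definition quad (R : nzRingType) (a2 a1 a0 : R) : {poly R} :=
  a2 *: 'X^2 + a1 *: 'X + a0%:P.

Definition qnum (R : nzRingType) (q : quadpair R) := quad (qa2 q) (qa1 q) (qa0 q).
Definition qden (R : nzRingType) (q : quadpair R) := quad (qb2 q) (qb1 q) (qb0 q).

Definition qmap (R S : Type) (h : R -> S) (q : quadpair R) : quadpair S :=
  let: QuadPair a2 a1 a0 b2 b1 b0 := q in
  QuadPair (h a2) (h a1) (h a0) (h b2) (h b1) (h b0).

Definition qratfun (K : fieldType) (q : quadpair K) : ratfun K :=
  (qnum q)%:F / (qden q)%:F.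

Section Quad.
Variable R : nzRingType.
Implicit Types a b c : R.

Lemma coef_quad a b c i : (quad a b c)`_i = [:: c; b; a]`_i.
Proof.
rewrite /quad !coefD !coefZ coefXn coefX coefC.
by case: i => [|[|[|i]]]; rewrite /= ?mulr0 ?mulr1 ?add0r ?addr0 ?nth_nil.
Qed.

Lemma size_quad a b c : (size (quad a b c) <= 3)%N.
Proof. by apply/leq_sizeP => -[|[|[|j]]] // _; rewrite coef_quad /= nth_nil. Qed.

Lemma quadE (p : {poly R}) : (size p <= 3)%N -> p = quad p`_2 p`_1 p`_0.
Proof.
move=> sp; apply/polyP => -[|[|[|i]]]; rewrite coef_quad //= nth_nil.
by rewrite nth_default // (leq_trans sp).
Qed.

Lemma quadZ a b c d : quad (d * a) (d * b) (d * c) = d *: quad a b c.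
Proof.
apply/polyP => i; rewrite coefZ !coef_quad.
by case: i => [|[|[|i]]] //=; rewrite !nth_nil mulr0.
Qed.

Lemma quad_eq0 a b c : (quad a b c == 0) = [&& a == 0, b == 0 & c == 0].
Proof.
apply/eqP/and3P => [e|[/eqP-> /eqP-> /eqP->]]; last first.
  by apply/polyP => -[|[|[|i]]]; rewrite coef_quad coef0 //= nth_nil.
have E i : [:: c; b; a]`_i = 0 by rewrite -coef_quad e coef0.
by split; apply/eqP; [exact: (E 2)|exact: (E 1)|exact: (E 0)].
Qed.

Lemma map_quad (S : nzRingType) (h : {rmorphism R -> S}) a b c :
  map_poly h (quad a b c) = quad (h a) (h b) (h c).
Proof. by rewrite /quad !rmorphD /= !linearZ /= map_polyXn map_polyX map_polyC. Qed.

Lemma qnum_map (S : nzRingType) (h : {rmorphism R -> S}) q :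
  map_poly h (qnum q) = qnum (qmap h q).
Proof. by case: q => *; rewrite /qnum map_quad. Qed.

Lemma qden_map (S : nzRingType) (h : {rmorphism R -> S}) q :
  map_poly h (qden q) = qden (qmap h q).
Proof. by case: q => *; rewrite /qden map_quad. Qed.

End Quad.

Lemma horner_quad (R : comNzRingType) (a b c x : R) :
  (quad a b c).[x] = a * x ^+ 2 + b * x + c.
Proof. by rewrite /quad !hornerE. Qed.

Section QMap.
Variables (R S : comNzRingType) (h : {rmorphism R -> S}).

Lemma qres_map q : qres (qmap h q) = h (qres q).
Proof. by case: q => *; rewrite /qres /=; ring. Qed.

Lemma sigma1num_map q : sigma1num (qmap h q) = h (sigma1num q).
Proof. by case: q => *; rewrite /sigma1num /=; ring. Qed.

Lemma sigma2num_map q : sigma2num (qmap h q) = h (sigma2num q).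
Proof. by case: q => *; rewrite /sigma2num /=; ring. Qed.

End QMap.

Section QScale.
Variable R : comNzRingType.
Implicit Type c : R.

Lemma qres_scale c q : qres (qmap ( *%R c) q) = c ^+ 4 * qres q.
Proof. by case: q => *; rewrite /qres /=; ring. Qed.

Lemma sigma1num_scale c q : sigma1num (qmap ( *%R c) q) = c ^+ 4 * sigma1num q.
Proof. by case: q => *; rewrite /sigma1num /=; ring. Qed.

Lemma sigma2num_scale c q : sigma2num (qmap ( *%R c) q) = c ^+ 4 * sigma2num q.
Proof. by case: q => *; rewrite /sigma2num /=; ring. Qed.

Lemma qnum_scale c q : qnum (qmap ( *%R c) q) = c *: qnum q.
Proof. by case: q => *; rewrite /qnum quadZ. Qed.

Lemma qden_scale c q : qden (qmap ( *%R c) q) = c *: qden q.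
Proof. by case: q => *; rewrite /qden quadZ. Qed.

End QScale.

Section Resultant.
Variable K : fieldType.
Implicit Types (q : quadpair K) (phi : ratfun K).

Lemma qres_coprime q : qres q != 0 -> coprimep (qnum q) (qden q).
Proof.
case: q => a2 a1 a0 b2 b1 b0; set r := qres _ => r0.
pose d20 := a2 * b0 - a0 * b2; pose d21 := a2 * b1 - a1 * b2.
apply/Bezout_coprimepP.
(* Eliminating X^2, then X, between F and G gives these Bezout cofactors. *)
exists (d21%:P * (b1%:P + b2%:P * 'X) - d20%:P * b2%:P,
        d20%:P * a2%:P - d21%:P * (a1%:P + a2%:P * 'X)).
set p := (X in X %= 1); suff -> : p = r%:P.
  by rewrite -size_poly_eq1 size_polyC r0.
by rewrite /p /r /qres /qnum /qden /quad -!mul_polyC /= /d20 /d21; ring.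
Qed.

(** If the resultant vanishes, the forms have a common root or are proportional.
Indeed d21^2 times the values of F and G at - d20 / d21 are the products of a2
and b2 with the resultant; and d21 = 0 forces d20 = 0, which makes the forms
proportional. A nonzero leading coefficient is required because a common root at
oo does not show in the polynomials. *)
Lemma coprime_qres q : coprimep (qnum q) (qden q) ->
  (qa2 q != 0) || (qb2 q != 0) -> qres q != 0.
Proof.
case: q => a2 a1 a0 b2 b1 b0 cop lead; apply/eqP => r0.
pose d20 := a2 * b0 - a0 * b2; pose d21 := a2 * b1 - a1 * b2.
have [d210|d210] := eqVneq d21 0.
  have d200 : d20 = 0.
    move/eqP: r0; rewrite /qres -/d21 -/d20 d210 mul0r subr0 expf_eq0.
    by move=> /eqP.
  have nc (a b c a' b' c' : K) : coprimep (quad a b c) (quad a' b' c') ->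
     a * b' = b * a' -> a * c' = c * a' -> a != 0 -> False.
    move=> cp e1 e2 anz.
    have e : quad a' b' c' = (a' / a) *: quad a b c.
      rewrite -quadZ; congr quad; apply: (mulfI anz).
      - by field.
      - by rewrite e1; field.
      - by rewrite e2; field.
    have : quad a b c %= 1.
      by apply: (coprimepP _ _ cp); rewrite ?e ?dvdp_scale // -mul_polyC dvdp_mulIr.
    rewrite -size_poly_eq1 => /eqP s1.
    by case/eqP: anz; rewrite -[a]/([:: c; b; a]`_2) -coef_quad nth_default ?s1.
  case/orP: lead => /= nz.
    by apply: (nc _ _ _ _ _ _ cop) => //; apply/eqP; rewrite -subr_eq0; apply/eqP.
  rewrite coprimep_sym in cop.
  apply: (nc _ _ _ _ _ _ cop) => //=.
    by apply/eqP; rewrite -subr_eq0 -oppr_eq0 -d210 /d21; apply/eqP; ring.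
  by apply/eqP; rewrite -subr_eq0 -oppr_eq0 -d200 /d20; apply/eqP; ring.
pose x := - d20 / d21.
have hx (a b c : K) :
    d21 ^+ 2 * (quad a b c).[x] = a * d20 ^+ 2 - b * d20 * d21 + c * d21 ^+ 2.
  by rewrite horner_quad /x; field.
have eF : d21 ^+ 2 * (qnum (QuadPair a2 a1 a0 b2 b1 b0)).[x] = 0.
  by rewrite hx -[RHS](mulr0 a2) -r0 /qres /= /d20 /d21; ring.
have eG : d21 ^+ 2 * (qden (QuadPair a2 a1 a0 b2 b1 b0)).[x] = 0.
  by rewrite hx -[RHS](mulr0 b2) -r0 /qres /= /d20 /d21; ring.
have d2 : d21 ^+ 2 != 0 by rewrite expf_neq0.
have rF : root (qnum (QuadPair a2 a1 a0 b2 b1 b0)) x.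
  by apply/eqP; apply: (mulfI d2); rewrite eF mulr0.
have := coprimep_root cop rF.
by rewrite -(mulrI_eq0 _ (mulfI d2)) eG eqxx.
Qed.

Lemma qres_lead q : qres q != 0 -> (qa2 q != 0) || (qb2 q != 0).
Proof.
case: q => a2 a1 a0 b2 b1 b0 /=; apply: contraNT; rewrite negb_or !negbK.
by case/andP=> /eqP-> /eqP->; rewrite /qres /=; apply/eqP; ring.
Qed.

Lemma qden_neq0 q : qres q != 0 -> qden q != 0.
Proof.
case: q => a2 a1 a0 b2 b1 b0; apply: contra; rewrite quad_eq0 /=.
by case/and3P=> /eqP-> /eqP-> /eqP->; rewrite /qres /=; apply/eqP; ring.
Qed.

Lemma size_qratfun q : qres q != 0 -> maxn (size (qnum q)) (size (qden q)) = 3%N.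
Proof.
move=> r0; apply/eqP; rewrite eqn_leq geq_max !size_quad /=.
rewrite leq_max; case/orP: (qres_lead r0) => nz; apply/orP; [left|right];
  rewrite ltnNge; apply: contra nz => /leq_sizeP/(_ 2)/(_ isT)/eqP;
  by rewrite coef_quad.
Qed.

Lemma qratfun_lowest q : qres q != 0 -> exists2 c, c != 0 &
  rnum (qratfun q) = qnum (qmap ( *%R c) q) /\
  rden (qratfun q) = qden (qmap ( *%R c) q).
Proof.
move=> r0; have [c c0 [eF eG]] :=
  rnum_rden_coprime (qden_neq0 r0) (qres_coprime r0).
exists c^-1; first by rewrite invr_eq0.
by split; [rewrite qnum_scale eF | rewrite qden_scale eG];
  rewrite scalerA mulVf // scale1r.
Qed.

Lemma rdeg_qratfun q : qres q != 0 -> rdeg (qratfun q) = 2%N.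
Proof.
move=> r0; have [c c0 [eF eG]] := qratfun_lowest r0.
by rewrite /rdeg eF eG size_qratfun // qres_scale mulf_neq0 ?expf_neq0.
Qed.

Lemma qratfun_scale c q : c != 0 -> qratfun (qmap ( *%R c) q) = qratfun q.
Proof.
move=> c0; rewrite /qratfun qnum_scale qden_scale -!mul_polyC ![c%:P * _]mulrC.
by rewrite frac_mulK ?polyC_eq0.
Qed.

Lemma rdeg2_qratfun phi : rdeg phi = 2%N ->
  exists2 q, phi = qratfun q & qres q != 0.
Proof.
rewrite /rdeg => d2.
have s3 : maxn (size (rnum phi)) (size (rden phi)) = 3%N.
  by case: maxn d2 => [|[|[|[|]]]].
pose q := QuadPair (rnum phi)`_2 (rnum phi)`_1 (rnum phi)`_0
  (rden phi)`_2 (rden phi)`_1 (rden phi)`_0.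
have [sn sd] : (size (rnum phi) <= 3)%N /\ (size (rden phi) <= 3)%N.
  by rewrite -s3 leq_maxl leq_maxr.
have en : qnum q = rnum phi by rewrite /qnum -quadE.
have ed : qden q = rden phi by rewrite /qden -quadE.
exists q; first by rewrite /qratfun en ed -rnum_rdenE.
apply: coprime_qres; first by rewrite en ed coprime_rnum_rden.
rewrite -negb_and; apply/negP => /andP[/eqP a0 /eqP b0].
have : (maxn (size (rnum phi)) (size (rden phi)) <= 2)%N.
  rewrite geq_max; apply/andP; split; apply/leq_sizeP => -[|[|[|j]]] // _.
    by apply: nth_default; rewrite (leq_trans sn).
  by apply: nth_default; rewrite (leq_trans sd).
by rewrite s3.
Qed.

(** A common factor of positive degree would make the degree of the map drop
below 2. This serves for the reduction of a pair, whose forms may a priori have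
a common factor. *)
Lemma rdeg2_qres q : qden q != 0 -> rdeg (qratfun q) = 2%N -> qres q != 0.
Proof.
move=> G0 /rdeg2_qratfun[q' e r'0].
have [c c0 [eF eG]] := qratfun_lowest r'0.
have [H] := rnum_rden_frac (qnum q) G0; rewrite -/(qratfun q) e eF eG => hF hG.
set q1 := qmap _ q' in hF hG.
have r1 : qres q1 != 0 by rewrite qres_scale mulf_neq0 ?expf_neq0.
have H0 : H != 0 by apply: contra_neq G0; rewrite hG => ->; rewrite mul0r.
(* The lowest terms already reach degree 2, so nothing is left for H. *)
have [h hE] : exists h, H = h%:P.
  suff : (size H <= 1)%N by move/size1_polyC=> ->; eexists.
  have key (p p' : {poly K}) : p = H * p' -> (size p <= 3)%N ->
      size p' = 3%N -> (size H <= 1)%N.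
    move=> -> + sp; have p'0 : p' != 0 by rewrite -size_poly_eq0 sp.
    by rewrite size_mul // sp addn3 /=; case: (size H) => [|[|]].
  move: (size_qratfun r1); rewrite /maxn; case: ifP => _ s.
    by apply: key hG _ s; rewrite size_quad.
  by apply: key hF _ s; rewrite size_quad.
have h0 : h != 0 by move: H0; rewrite hE polyC_eq0.
have : qres (qmap ( *%R h) q1) != 0 by rewrite qres_scale mulf_neq0 ?expf_neq0.
suff -> : qmap ( *%R h) q1 = q by [].
have cE (p : quadpair K) : p = QuadPair (qnum p)`_2 (qnum p)`_1 (qnum p)`_0
    (qden p)`_2 (qden p)`_1 (qden p)`_0.
  by case: p => *; rewrite /qnum /qden !coef_quad.
by rewrite [LHS]cE [RHS]cE qnum_scale qden_scale hF hG hE !mul_polyC.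
Qed.

End Resultant.

Lemma rmap_qratfun (K L : fieldType) (h : {rmorphism K -> L}) (q : quadpair K) :
  qres q != 0 -> rmap h (qratfun q) = qratfun (qmap h q).
Proof.
move=> r0; have [c c0 [eF eG]] := qratfun_lowest r0.
rewrite /rmap eF eG qnum_map qden_map -/(qratfun _).
rewrite -(@qratfun_scale _ (h c) (qmap h q)) ?fmorph_eq0 //; congr qratfun.
by case: q {r0 eF eG} => * /=; rewrite !rmorphM.
Qed.

(** * Conjugation in coordinates *)

Lemma homogenize2 (K : fieldType) (a b c n d : K) : d != 0 ->
  a * (n / d) ^+ 2 + b * (n / d) + c
    = (a * n ^+ 2 + b * (n * d) + c * d ^+ 2) / d ^+ 2.
Proof. by move=> d0; field. Qed.

Lemma mulmx2E (R : comNzRingType) (A B : 'M[R]_2) i j :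
  (A *m B) i j = A i 0 * B 0 j + A i 1 * B 1 j.
Proof.
rewrite mxE big_ord_recl big_ord1.
by have -> : lift ord0 ord0 = 1 :> 'I_2 by exact: val_inj.
Qed.

Section Conj.
Variable K : fieldType.
Implicit Types (q : quadpair K) (N D : {poly K}).

Definition homog2 (a b c : K) N D : {poly K} :=
  a *: N ^+ 2 + b *: (N * D) + c *: D ^+ 2.

Lemma reval_quad (a b c : K) N D : D != 0 ->
  reval (quad a b c) (N%:F / D%:F) = (homog2 a b c N D)%:F / (D ^+ 2)%:F.
Proof.
move=> D0; have D0F : D%:F != 0 :> ratfun K by rewrite tofrac_eq0.
rewrite /reval (map_quad (@FracField.tofrac {poly K} \o polyC)) horner_quad /=.
rewrite /homog2 -!mul_polyC 2!tofracD !(tofracM, tofracXn).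
exact: homogenize2.
Qed.

(** Substituting N/D amounts to evaluating the homogenized forms at (N, D). The
scalar relating the given forms to the lowest terms cancels. *)
Lemma rcomp_quad (p2 p1 p0 r2 r1 r0 : K) N D :
  coprimep (quad p2 p1 p0) (quad r2 r1 r0) -> quad r2 r1 r0 != 0 -> D != 0 ->
  rcomp ((quad p2 p1 p0)%:F / (quad r2 r1 r0)%:F) (N%:F / D%:F)
    = (homog2 p2 p1 p0 N D)%:F / (homog2 r2 r1 r0 N D)%:F.
Proof.
move=> cop G0 D0; have [c c0 [eF eG]] := rnum_rden_coprime G0 cop.
set phi := _ / _ in eF eG *.
have D20F : (D ^+ 2)%:F != 0 :> ratfun K by rewrite tofrac_eq0 expf_neq0.
rewrite /rcomp.
have -> : rnum phi = quad (c^-1 * p2) (c^-1 * p1) (c^-1 * p0).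
  by rewrite quadZ eF scalerA mulVf // scale1r.
have -> : rden phi = quad (c^-1 * r2) (c^-1 * r1) (c^-1 * r0).
  by rewrite quadZ eG scalerA mulVf // scale1r.
rewrite !reval_quad // -mulf_div divff ?invr_eq0 // mulr1.
have hZ a1 a2 a3 : homog2 (c^-1 * a1) (c^-1 * a2) (c^-1 * a3) N D =
    homog2 a1 a2 a3 N D * (c^-1)%:P.
  by rewrite [RHS]mulrC mul_polyC /homog2 -!scalerA -!scalerDr.
by rewrite !hZ frac_mulK // polyC_eq0 invr_eq0.
Qed.

(** Conjugation acts on coefficients as [qsubst]: both compositions clear their
denominators, and the scalar det A between inverse and adjugate does not change
the quotient. *)
Lemma rconj_qratfun q (A : 'M[K]_2) : A \in unitmx -> qres q != 0 ->
  rconj (qratfun q) A = qratfun (qsubst q (A 0 0) (A 0 1) (A 1 0) (A 1 1)).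
Proof.
move=> uA r0; set B := invmx A.
have BA : B *m A = 1%:M by rewrite mulVmx.
have Bij i j : B i 0 * A 0 j + B i 1 * A 1 j = (i == j)%:R.
  by rewrite -mulmx2E BA mxE.
have := (Bij 0 0 : _ = 1, Bij 0 1 : _ = 0, Bij 1 0 : _ = 0, Bij 1 1 : _ = 1).
set a := A 0 0; set b := A 0 1; set c := A 1 0; set d := A 1 1.
rewrite /rconj /mobius -/a -/b -/c -/d -/B.
move: (B 0 0) (B 0 1) (B 1 0) (B 1 1) => a' b' c' d' [[[e00 e01] e10] e11].
have dd : (a' * d' - b' * c') * (a * d - b * c) = 1.
  rewrite -[RHS]mulr1 -{1}e00 -e11 -[LHS]addr0.
  by rewrite -[X in _ + X](mulr0 (a' * b + b' * d)) -e10; ring.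
have [d0 d'0] : a * d - b * c != 0 /\ a' * d' - b' * c' != 0.
  by apply/andP; rewrite -negb_or orbC -mulf_eq0 dd oner_neq0.
set e := a * d - b * c in dd d0.
(* The entries of e A^-1 are those of the adjugate of A. *)
have ea : e * a' = d.
  rewrite -[RHS]mulr1 -e00 -[RHS]subr0 -(mulr0 c) -e01 /e; ring.
have eb : e * b' = - b.
  rewrite -[RHS]mulr1 -e00 -[RHS]addr0 -(mulr0 a) -e01 /e; ring.
have ec : e * c' = - c.
  rewrite -[RHS]mulr1 -e11 -[RHS]addr0 -(mulr0 d) -e10 /e; ring.
have ed : e * d' = a.
  rewrite -[RHS]mulr1 -e11 -[RHS]subr0 -(mulr0 b) -e10 /e; ring.
have quad1 (x y : K) : x *: 'X + y%:P = quad 0 x y by rewrite /quad scale0r add0r.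
have cop1 (x y z t : K) : x * t - y * z != 0 ->
    coprimep (quad 0 x y) (quad 0 z t) /\ quad 0 z t != 0.
  move=> nz; split; last first.
    apply: contraNneq nz => /eqP; rewrite quad_eq0 => /and3P[_ /eqP-> /eqP->].
    by apply/eqP; ring.
  apply/Bezout_coprimepP; exists (- z%:P, x%:P); set p := (X in X %= 1).
  have -> : p = (x * t - y * z)%:P by rewrite /p /quad -!mul_polyC /=; ring.
  by rewrite -size_poly_eq1 size_polyC nz.
have [cop' D'0] := cop1 _ _ _ _ d'0; have [cop D0] := cop1 _ _ _ _ d0.
case: q r0 => a2 a1 a0 b2 b1 b0 r0; set q := QuadPair _ _ _ _ _ _ in r0 *.
rewrite !quad1 /qratfun rcomp_quad ?qden_neq0 //.
pose q1 := QuadPair (a' * a2 + b' * b2) (a' * a1 + b' * b1) (a' * a0 + b' * b0)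
   (c' * a2 + d' * b2) (c' * a1 + d' * b1) (c' * a0 + d' * b0).
have rq1 : qres q1 != 0.
  have -> : qres q1 = (a' * d' - b' * c') ^+ 2 * qres q by rewrite /qres /=; ring.
  by rewrite mulf_neq0 ?expf_neq0.
(* Composition on the left mixes the two forms, and on the right it
   substitutes; each time a power of the denominator cancels. *)
have inner (x y : K) : homog2 0 x y (qnum q) (qden q) =
    quad (x * a2 + y * b2) (x * a1 + y * b1) (x * a0 + y * b0) * qden q.
  by rewrite /homog2 /quad /qnum /qden /quad -!mul_polyC /=; ring.
rewrite !inner frac_mulK ?qden_neq0 // rcomp_quad //; last first.
- exact: (qden_neq0 rq1).
- exact: (qres_coprime rq1).
have outer (x y z : K) : homog2 x y z (quad 0 a b) (quad 0 c d) =
    quad (x * a ^+ 2 + y * a * c + z * c ^+ 2)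
         (x * a * b *+ 2 + y * (a * d + b * c) + z * c * d *+ 2)
         (x * b ^+ 2 + y * b * d + z * d ^+ 2).
  by rewrite /homog2 /quad -!mul_polyC; ring.
rewrite !outer.
set x2 := (X in (quad X _ _)%:F / _); set x1 := (X in (quad _ X _)%:F / _).
set x0 := (X in (quad _ _ X)%:F / _); set y2 := (X in _ / (quad X _ _)%:F).
set y1 := (X in _ / (quad _ X _)%:F); set y0 := (X in _ / (quad _ _ X)%:F).
rewrite -[LHS]/(qratfun (QuadPair x2 x1 x0 y2 y1 y0)) -(qratfun_scale _ d0).
have eab x y : d * x - b * y = e * (a' * x + b' * y).
  by rewrite mulrDr !mulrA ea eb mulNr.
have ecd x y : a * y - c * x = e * (c' * x + d' * y).
  by rewrite mulrDr !mulrA ec ed mulNr addrC.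
congr qratfun; rewrite /qsubst /= !eab !ecd.
by congr QuadPair; rewrite /x2 /x1 /x0 /y2 /y1 /y0; ring.
Qed.

End Conj.

(** * The multiplier invariants as functions of the coefficients *)

Definition qmultiplier (K : fieldType) (q : quadpair K) (z : K) : K :=
  ((qnum q)^`().[z] * (qden q).[z] - (qnum q).[z] * (qden q)^`().[z])
    / (qden q).[z] ^+ 2.

Lemma rderiv_qratfun (K : fieldType) (q : quadpair K) z : qres q != 0 ->
  rderiv_at (qratfun q) z = qmultiplier q z.
Proof.
move=> r0; have [c c0 [eF eG]] := qratfun_lowest r0.
rewrite /rderiv_at eF eG qnum_scale qden_scale !derivZ !hornerZ /qmultiplier.
have [->|g0] := eqVneq (qden q).[z] 0.
  by rewrite !mulr0 expr0n /= !invr0 !mulr0.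
by field; rewrite g0.
Qed.

Lemma deriv_quad (R : comNzRingType) (a b c z : R) :
  (quad a b c)^`().[z] = a *+ 2 * z + b.
Proof.
rewrite /quad !derivE !hornerE /= -mulr_natl; ring.
Qed.

Lemma cubic_eq0 (R : comNzRingType) (c3 c2 c1 c0 : R) :
  c3 *: 'X^3 + quad c2 c1 c0 = 0 -> [/\ c3 = 0, c2 = 0, c1 = 0 & c0 = 0].
Proof.
move=> e; have E i : (c3 *: 'X^3 + quad c2 c1 c0)`_i = 0 by rewrite e coef0.
have E' i : c3 * (i == 3%N)%:R + [:: c0; c1; c2]`_i = 0.
  by rewrite -[RHS](E i) coefD coefZ coefXn coef_quad.
split; [have := E' 3%N|have := E' 2%N|have := E' 1%N|have := E' 0%N];
  by rewrite /= ?mulr1 ?mulr0 ?add0r ?addr0.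
Qed.

(** Exchanging 0 and oo reverses the coefficients of both forms. When oo is
fixed, that is b2 = 0, the derivative at 0 of the exchanged map only involves
the leading coefficients. *)
Lemma multiplier_oo (K : fieldType) (q : quadpair K) : qres q != 0 ->
  qb2 q = 0 -> multiplier (qratfun q) None = qb1 q / qa2 q.
Proof.
move=> r0 b20; set A := (X in multiplier X _); rewrite /multiplier {}/A.
set A := \matrix_(i, j) _.
have uA : A \in unitmx.
  suff: A *m A = 1%:M by case/mulmx1_unit.
  apply/matrixP => i j; rewrite !mxE big_ord_recl big_ord1 !mxE.
  by case: i j => [[|[|?]] ?] [[|[|?]] ?] //=;
    rewrite ?(mulr0, mul0r, addr0, add0r, mulr1).
have rs : qres (qsubst q (A 0 0) (A 0 1) (A 1 0) (A 1 1)) != 0.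
  rewrite qres_subst mulf_neq0 // !mxE /= mulr0 mulr1 sub0r.
  by rewrite expf_neq0 // oppr_eq0 oner_neq0.
rewrite rconj_qratfun // rderiv_qratfun //.
have a20 : qa2 q != 0 by have := qres_lead r0; rewrite b20 eqxx orbF.
case: q r0 b20 a20 {rs} => a2 a1 a0 b2 b1 b0 /= r0 b20 a20.
rewrite !mxE /= /qmultiplier /qnum /qden !deriv_quad !horner_quad /= b20.
by field; rewrite oppr_eq0 a20.
Qed.

Section Sigma.
Variable C : closedFieldType.
Implicit Types q : quadpair C.

(** The finite fixed points are the roots of F - X G, and each missing root is a
fixed point at oo. At a root z one has F = z G, so that the multiplier is (F' -
z G') / G. Writing F in terms of G and of the roots turns the resultant, up to
sign, into a product of the values of G at the roots and of leading
coefficients. No denominator vanishes, and the two formulas become identities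
between rational functions, one for each number of finite fixed points. *)
Lemma sigma_fixpoly_factors q (l : C) (r : seq C) :
  qnum q - 'X * qden q = l *: \prod_(z <- r) ('X - z%:P) -> l != 0 ->
  qres q != 0 ->
  let L := nseq (3 - size r) (multiplier (qratfun q) None)
             ++ map (qmultiplier q) r in
  L`_0 + L`_1 + L`_2 = sigma1num q / qres q /\
  L`_0 * L`_1 + L`_0 * L`_2 + L`_1 * L`_2 = sigma2num q / qres q.
Proof.
move=> e l0 r0 L.
(* A fixed point that is a zero of G would be a common zero of F and G. *)
have gz z : z \in r -> (qden q).[z] != 0 /\ (qnum q).[z] = z * (qden q).[z].
  move=> zr; have fz : (qnum q).[z] = z * (qden q).[z].
    apply/eqP; rewrite -subr_eq0; have := congr1 (fun p => p.[z]) e.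
    rewrite !hornerE => ->; rewrite mulf_eq0 -[X in _ || X]/(root _ z).
    by rewrite root_prod_XsubC zr orbT.
  split=> //; apply/eqP => g0.
  have := coprimep_root (qres_coprime r0) (_ : root _ z).
  by rewrite g0 eqxx /root fz g0 mulr0 eqxx => /(_ isT).
have Lam z : z \in r -> qmultiplier q z =
    ((qnum q)^`().[z] - z * (qden q)^`().[z]) / (qden q).[z].
  by move=> /gz[g0 fz]; rewrite /qmultiplier fz; field.
have sr : (size r <= 3)%N.
  have : (size (qnum q - 'X * qden q)%R <= 4)%N.
    rewrite (leq_trans (size_polyD _ _)) // geq_max size_polyN.
    rewrite (leq_trans (size_quad _ _ _)) //=.
    rewrite (leq_trans (size_polyMleq _ _)) // size_polyX.
    by rewrite (leq_ltn_trans _ (_ : 3 < 4)%N) // size_quad.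
  by rewrite e size_scale // size_prod_XsubC.
case: q e r0 @L gz Lam => a2 a1 a0 b2 b1 b0 e r0.
set q := QuadPair _ _ _ _ _ _ in e r0 *.
move=> L gz Lam.
have eqs (c3 c2 c1 c0 : C) :
    c3 *: 'X^3 + quad c2 c1 c0 = l *: \prod_(z <- r) ('X - z%:P) ->
    [/\ b2 = - c3, a2 = b1 + c2, a1 = b0 + c1 & a0 = c0].
  move=> e'.
  have : (- b2 - c3) *: 'X^3
    + quad (a2 - b1 - c2) (a1 - b0 - c1) (a0 - c0) = 0.
    rewrite -[RHS](subrr (l *: \prod_(z <- r) ('X - z%:P))) -{1}e -e'.
    by rewrite /qnum /qden /quad -!mul_polyC /=; ring.
  move/cubic_eq0 => [/subr0_eq e3 /subr0_eq e2 /subr0_eq e1 /subr0_eq e0].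
  split=> //; first by rewrite -e3 opprK.
  - by rewrite -e2 addrC subrK.
  - by rewrite -e1 addrC subrK.
rewrite {}/L; move: (multiplier_oo r0); move: (multiplier _ None) => moo mooE.
set S1 := sigma1num q; set S2 := sigma2num q; set res := qres q.
move: sr eqs gz Lam; case: r {e} => [|z1 [|z2 [|z3 [|]]]] //= _ eqs gz Lam.
- have [b20 a2E a1E a0E] : [/\ b2 = 0, a2 = b1, a1 = b0 & a0 = l].
    have [|-> -> -> ->] := eqs 0 0 0 l; last by rewrite oppr0 !addr0.
    by rewrite big_nil /quad -!mul_polyC; ring.
  have b10 : b1 != 0 by have := qres_lead r0; rewrite /= b20 eqxx orbF a2E.
  have rE : qres q = b1 ^+ 3 * l by rewrite /qres /= b20 a2E a1E a0E; ring.
  rewrite -/res in rE.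
  rewrite mooE // rE /S1 /S2 /sigma1num /sigma2num /= b20 a2E a1E a0E divff //.
  by split; field; rewrite ?oppr_eq0; do ?[apply/andP; split].
- have [b20 a2E a1E a0E] : [/\ b2 = 0, a2 = b1, a1 = b0 + l & a0 = - l * z1].
    have [|-> -> -> ->] := eqs 0 0 l (- l * z1); last by rewrite oppr0 addr0.
    by rewrite big_seq1 /quad -!mul_polyC; ring.
  have b10 : b1 != 0 by have := qres_lead r0; rewrite /= b20 eqxx orbF a2E.
  have [] := gz z1 (mem_head _ _); rewrite /qden horner_quad /= b20 mul0r add0r.
  move=> g1 _.
  rewrite Lam ?mem_head // mooE // /qnum /qden !deriv_quad horner_quad.
  have rE : qres q = - l * b1 ^+ 2 * (b1 * z1 + b0).
    by rewrite /qres /= b20 a2E a1E a0E; ring.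
  rewrite -/res in rE.
  rewrite rE /S1 /S2 /sigma1num /sigma2num /= b20 a2E a1E a0E divff // mul0r add0r.
  by split; field; rewrite ?oppr_eq0; do ?[apply/andP; split].
- have [b20 a2E a1E a0E] : [/\ b2 = 0, a2 = b1 + l, a1 = b0 - l * (z1 + z2)
      & a0 = l * z1 * z2].
    have [|-> -> -> ->] := eqs 0 l (- l * (z1 + z2)) (l * z1 * z2).
      by rewrite big_cons big_seq1 /quad -!mul_polyC; ring.
    by rewrite oppr0 mulNr.
  have a20 : b1 + l != 0 by have := qres_lead r0; rewrite /= b20 eqxx orbF a2E.
  have [] := gz z1 (mem_head _ _); rewrite /qden horner_quad /= b20 mul0r add0r.
  move=> g1 _.
  have z2r : z2 \in [:: z1; z2] by rewrite !inE eqxx orbT.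
  have [] := gz z2 z2r; rewrite /qden horner_quad /= b20 mul0r add0r.
  move=> g2 _.
  rewrite !Lam ?mem_head // mooE // /qnum /qden !deriv_quad !horner_quad.
  have rE : qres q = l * (b1 + l) * (b1 * z1 + b0) * (b1 * z2 + b0).
    by rewrite /qres /= b20 a2E a1E a0E; ring.
  rewrite -/res in rE.
  rewrite rE /S1 /S2 /sigma1num /sigma2num /= b20 a2E a1E a0E !mul0r !add0r.
  by split; field; rewrite ?oppr_eq0; do ?[apply/andP; split].
- have [b2E a2E a1E a0E] : [/\ b2 = - l, a2 = b1 - l * (z1 + z2 + z3),
      a1 = b0 + l * (z1 * z2 + z1 * z3 + z2 * z3) & a0 = - l * z1 * z2 * z3].
    have [|-> -> -> ->] := eqs l (- l * (z1 + z2 + z3))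
      (l * (z1 * z2 + z1 * z3 + z2 * z3)) (- l * z1 * z2 * z3);
      last by rewrite mulNr.
    by rewrite !big_cons big_nil /quad -!mul_polyC; ring.
  have z2r : z2 \in [:: z1; z2; z3] by rewrite !inE eqxx orbT.
  have z3r : z3 \in [:: z1; z2; z3] by rewrite !inE eqxx !orbT.
  have [+ _] := gz z1 (mem_head _ _); rewrite /qden horner_quad /= b2E => g1.
  have [+ _] := gz z2 z2r; rewrite /qden horner_quad /= b2E => g2.
  have [+ _] := gz z3 z3r; rewrite /qden horner_quad /= b2E => g3.
  rewrite !Lam ?mem_head // /qnum /qden !deriv_quad !horner_quad.
  have rE : qres q = - l * (- l * z1 ^+ 2 + b1 * z1 + b0)
     * (- l * z2 ^+ 2 + b1 * z2 + b0) * (- l * z3 ^+ 2 + b1 * z3 + b0).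
    by rewrite /qres /= b2E a2E a1E a0E; ring.
  rewrite -/res in rE.
  rewrite rE /S1 /S2 /sigma1num /sigma2num /= b2E a2E a1E a0E.
  by split; field; rewrite ?oppr_eq0; do ?[apply/andP; split].
Qed.

(** A map all of whose points are fixed is the identity, which has degree 1. *)
Lemma fixpoly_neq0 q : qres q != 0 -> qnum q - 'X * qden q != 0.
Proof.
case: q => a2 a1 a0 b2 b1 b0; apply: contra_neq => e.
have [e3 e2 e1 e0] : [/\ - b2 = 0, a2 - b1 = 0, a1 - b0 = 0 & a0 = 0].
  by apply: cubic_eq0; rewrite -e /qnum /qden /quad -!mul_polyC /=; ring.
move: e2 e1 => /subr0_eq -> /subr0_eq ->; rewrite e0 -[b2]opprK e3 /qres.
ring.
Qed.

Theorem sigma_qratfun q : qres q != 0 ->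
  sigma1 (qratfun q) = sigma1num q / qres q /\
  sigma2 (qratfun q) = sigma2num q / qres q.
Proof.
move=> r0; have [c c0 [eF eG]] := qratfun_lowest r0.
have rc : qres (qmap ( *%R c) q) != 0 by rewrite qres_scale mulf_neq0 ?expf_neq0.
have -> : sigma1num q / qres q =
    sigma1num (qmap ( *%R c) q) / qres (qmap ( *%R c) q).
  by rewrite sigma1num_scale qres_scale; field; rewrite r0 c0.
have -> : sigma2num q / qres q =
    sigma2num (qmap ( *%R c) q) / qres (qmap ( *%R c) q).
  by rewrite sigma2num_scale qres_scale; field; rewrite r0 c0.
(* All terms are invariant under scaling, so q may be taken in the
   normalization of the lowest terms. *)
rewrite -(qratfun_scale q c0) in eF eG *.
move: (qmap _ q) rc eF eG => {c0 r0}q r0 eF eG.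
rewrite /sigma1 /sigma2 /multipliers /fixpoints /fixpoly rdeg_qratfun // eF eG.
have p0 := fixpoly_neq0 r0; case: closed_field_poly_normal => /= r e.
have l0 : lead_coef (qnum q - 'X * qden q) != 0 by rewrite lead_coef_eq0.
have sE : size (qnum q - 'X * qden q) = (size r).+1.
  by rewrite e size_scale // size_prod_XsubC.
rewrite map_cat map_nseq -map_comp sE subSS.
have -> : map (multiplier (qratfun q) \o Some) r = map (qmultiplier q) r.
  by apply: eq_map => z /=; rewrite rderiv_qratfun.
exact: (sigma_fixpoly_factors e).
Qed.

End Sigma.

(** * Conjugacy classes and normal forms *)

Section Conjugacy.
Variable K : fieldType.
Implicit Types q : quadpair K.

(** The scalar k is allowed because a pair is determined by its map only up to a
scalar. *)
Definition qconj q q' := exists a b c d k : K,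
  [/\ a * d - b * c != 0, k != 0 & qsubst q a b c d = qmap ( *%R k) q'].

Lemma qconj_subst q a b c d : a * d - b * c != 0 -> qconj q (qsubst q a b c d).
Proof.
exists a, b, c, d, 1; split; rewrite ?oner_neq0 //.
by case: qsubst => * /=; rewrite !mul1r.
Qed.

Lemma qsubst_scale k q a b c d :
  qsubst (qmap ( *%R k) q) a b c d = qmap ( *%R k) (qsubst q a b c d).
Proof. by case: q => *; rewrite /qsubst /=; congr QuadPair; ring. Qed.

Lemma qsubst_comp q a b c d a' b' c' d' :
  qsubst (qsubst q a b c d) a' b' c' d' =
  qsubst q (a * a' + b * c') (a * b' + b * d') (c * a' + d * c') (c * b' + d * d').
Proof. by case: q => *; rewrite /qsubst /=; congr QuadPair; ring. Qed.

Lemma qconj_trans q1 q2 q3 : qconj q1 q2 -> qconj q2 q3 -> qconj q1 q3.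
Proof.
move=> [a [b [c [d [k [e0 k0 e]]]]]] [a' [b' [c' [d' [k' [e0' k0' e']]]]]].
exists (a * a' + b * c'), (a * b' + b * d').
exists (c * a' + d * c'), (c * b' + d * d'), (k * k').
split; last first.
- rewrite -qsubst_comp e qsubst_scale e'.
  by case: q3 {e'} => * /=; rewrite !mulrA.
- by rewrite mulf_neq0.
have := mulf_neq0 e0 e0'; congr (_ != 0); ring.
Qed.

Lemma qconj_sigma q q' : qconj q q' -> qres q != 0 ->
  [/\ qres q' != 0, sigma1num q' / qres q' = sigma1num q / qres q
    & sigma2num q' / qres q' = sigma2num q / qres q].
Proof.
move=> [a [b [c [d [k [e0 k0 e]]]]]] r0.
have := qres_subst q a b c d.
have := sigma1num_subst q a b c d; have := sigma2num_subst q a b c d.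
rewrite e qres_scale sigma1num_scale sigma2num_scale; set D := (_ - _) in e0 *.
move=> e2 e1 er; have k4 : k ^+ 4 != 0 by rewrite expf_neq0.
have r'0 : qres q' != 0.
  by rewrite -(mulrI_eq0 _ (mulfI k4)) er mulf_neq0 ?expf_neq0.
have D6 : D ^+ 6 != 0 by rewrite expf_neq0.
have cancel (x x' : K) : k ^+ 4 * x' = D ^+ 6 * x -> x' / qres q' = x / qres q.
  move=> ex; transitivity ((k ^+ 4 * x') / (k ^+ 4 * qres q')).
    by field; rewrite r'0 k0.
  by rewrite ex er; field; rewrite r0 e0.
by split=> //; apply: cancel.
Qed.

Definition mx2 a b c d : 'M[K]_2 := \matrix_(i, j)
  if i == 0 then if j == 0 then a else b else if j == 0 then c else d.

Lemma mx2_unit a b c d : a * d - b * c != 0 -> mx2 a b c d \in unitmx.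
Proof.
move=> e0; set e := _ - _ in e0.
suff : mx2 a b c d *m mx2 (d / e) (- b / e) (- c / e) (a / e) = 1%:M.
  by case/mulmx1_unit.
apply/matrixP => i j; rewrite !mxE big_ord_recl big_ord1 !mxE.
by case: i j => [[|[|?]] ?] [[|[|?]] ?] //=; rewrite /e; field.
Qed.

Lemma det2_neq0 (A : 'M[K]_2) : A \in unitmx ->
  A 0 0 * A 1 1 - A 0 1 * A 1 0 != 0.
Proof.
move=> uA; have BA : invmx A *m A = 1%:M by rewrite mulVmx.
have Bij i j : invmx A i 0 * A 0 j + invmx A i 1 * A 1 j = (i == j)%:R.
  by rewrite -mulmx2E BA mxE.
have := (Bij 0 0 : _ = 1, Bij 0 1 : _ = 0, Bij 1 0 : _ = 0, Bij 1 1 : _ = 1).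
move: (invmx A 0 0) (invmx A 0 1) (invmx A 1 0) (invmx A 1 1).
move=> a b c d [[[e00 e01] e10] e11].
suff dd : (a * d - b * c) * (A 0 0 * A 1 1 - A 0 1 * A 1 0) = 1.
  by apply: contra_eq_neq dd => ->; rewrite mulr0 eq_sym oner_neq0.
(* This is det (A^-1) det A = det (A^-1 A). *)
transitivity ((a * A 0 0 + b * A 1 0) * (c * A 0 1 + d * A 1 1)
  - (a * A 0 1 + b * A 1 1) * (c * A 0 0 + d * A 1 0)); first by ring.
by rewrite e00 e01 e10 e11 mul0r subr0 mulr1.
Qed.

Lemma qconj_rconj q q' : qconj q q' -> qres q != 0 ->
  exists2 A, A \in unitmx & rconj (qratfun q) A = qratfun q'.
Proof.
move=> [a [b [c [d [k [e0 k0 e]]]]]] r0.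
exists (mx2 a b c d); first exact: mx2_unit.
by rewrite rconj_qratfun ?mx2_unit // !mxE /= e qratfun_scale.
Qed.

End Conjugacy.

Section NormalForms.
Variable C : closedFieldType.
Implicit Types q : quadpair C.

Lemma qconj_fix_oo q : qres q != 0 -> exists2 q', qconj q q' & qb2 q' = 0.
Proof.
move=> r0; have [b20|b20] := eqVneq (qb2 q) 0.
  exists (qsubst q 1 0 0 1).
    by apply: qconj_subst; rewrite mulr1 mulr0 subr0 oner_neq0.
  by case: q b20 {r0} => a2 a1 a0 b2 b1 b0 /= ->; ring.
have /closed_rootP[r /eqP rr] : size (qnum q - 'X * qden q) != 1%N.
  apply: contraNneq b20 => s1.
  have /leq_sizeP/(_ 3%N isT) : (size (qnum q - 'X * qden q)%R <= 3)%N.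
    by rewrite s1.
  rewrite coefB coefXM !coef_quad /= => /eqP.
  by rewrite sub0r oppr_eq0.
(* The change of coordinates z |-> r + 1/z sends oo to the fixed point r. *)
exists (qsubst q r 1 1 0).
  by apply: qconj_subst; rewrite mulr0 mulr1 sub0r oppr_eq0 oner_neq0.
move: rr; case: q {r0 b20} => a2 a1 a0 b2 b1 b0.
rewrite hornerD hornerN hornerM hornerX !horner_quad /= => e.
by rewrite -[RHS]oppr0 -e; ring.
Qed.

Lemma sqrt_exists (x : C) : exists y, y ^+ 2 = x.
Proof.
have [y] := @solve_monicpoly C 2 (fun i => if i == 0%N then x else 0) isT.
by rewrite !big_ord_recl big_ord0 /= mul0r !addr0 mulr1; exists y.
Qed.

(** When oo is fixed with nonzero multiplier, exactly one other point is mapped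
to oo. The translation by t moves it to 0, and the scaling by s makes the
constant and leading coefficients of the numerator equal. *)
Lemma normal_form_unit q : qres q != 0 -> qb2 q = 0 -> qb1 q != 0 ->
  exists t, qconj q (QuadPair 1 t 1 0 (qb1 q / qa2 q) 0).
Proof.
move=> r0 b20; have a20 : qa2 q != 0.
  by have := qres_lead r0; rewrite b20 eqxx orbF.
case: q r0 b20 a20 => a2 a1 a0 b2 b1 b0 /= r0 b20 a20 b10.
pose t := - b0 / b1; pose c0 := a2 * t ^+ 2 + a1 * t + a0.
have c00 : c0 != 0.
  apply: contraNneq r0 => c00; apply/eqP.
  transitivity (a2 * b1 ^+ 2 * c0); last by rewrite c00 mulr0.
  by rewrite b20 /c0 /t; field.
have [s s2] := sqrt_exists (c0 / a2).
have s0 : s != 0.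
  by have : s ^+ 2 != 0; [rewrite s2 mulf_neq0 ?invr_eq0|rewrite expf_eq0].
exists ((2 * a2 * t + a1 - t * b1) * s / c0), s, t, 0, 1, c0; split=> //.
  by rewrite mulr1 mulr0 subr0.
have c0E : a2 * s ^+ 2 = c0 by rewrite s2; field.
rewrite b20 /=; congr QuadPair.
- by rewrite -c0E; ring.
- by field.
- by rewrite /c0 /t; field.
- by ring.
- by rewrite -c0E; field.
- by rewrite /t; field.
Qed.

(** A fixed point at oo with multiplier different from 1 is simple, so there is
a finite fixed point t. Once it is moved to 0, the scaling by s makes the
leading coefficient of F equal to the constant coefficient of G. *)
Lemma normal_form_nonunit q : qres q != 0 -> qb2 q = 0 -> qb1 q != qa2 q ->
  exists m, qconj q (QuadPair 1 m 0 0 (qb1 q / qa2 q) 1).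
Proof.
move=> r0 b20; have a20 : qa2 q != 0.
  by have := qres_lead r0; rewrite b20 eqxx orbF.
case: q r0 b20 a20 => a2 a1 a0 b2 b1 b0 /= r0 b20 a20 ab.
have /closed_rootP[t /eqP] : size (quad (a2 - b1) (a1 - b0) a0) != 1%N.
  apply: contraNneq ab => s1.
  have /leq_sizeP/(_ 2%N isT) : (size (quad (a2 - b1) (a1 - b0) a0)%R <= 2)%N.
    by rewrite s1.
  by rewrite coef_quad /= => /subr0_eq ->.
rewrite horner_quad => et.
pose c0 := b1 * t + b0; pose c1 := 2 * a2 * t + a1 - t * b1.
(* The equation of the fixed point t, solved for a0. *)
have a0E : a0 = t * c0 - a2 * t ^+ 2 - a1 * t.
  by rewrite -[LHS]subr0 -et /c0; ring.
have c00 : c0 != 0.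
  apply: contraNneq r0 => c00; apply/eqP.
  transitivity (c0 * (a2 ^+ 2 * c0 - a2 * b1 * c1)); last by rewrite c00 mul0r.
  by rewrite b20 a0E /c0 /c1; ring.
pose s := c0 / a2.
have s0 : s != 0 by rewrite mulf_neq0 ?invr_eq0.
exists (c1 / c0), s, t, 0, 1, (s * c0); split; [|exact: mulf_neq0|].
  by rewrite mulr1 mulr0 subr0.
rewrite b20 a0E /=; congr QuadPair; rewrite /s.
- by field.
- by rewrite /c1; field; rewrite a20 c00.
- by rewrite /c0; ring.
- by ring.
- by field.
- by rewrite /c0; field.
Qed.

End NormalForms.

(** * Valuation subrings *)

Definition subringP (L : fieldType) (R : L -> Prop) :=
  [/\ R 1, forall x y, R x -> R y -> R (x - y)
    & forall x y, R x -> R y -> R (x * y)].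

Section Subring.
Variables (L : fieldType) (R : L -> Prop) (sR : subringP R).

Lemma subring1 : R 1.
Proof. by case: sR. Qed.

Lemma subringB x y : R x -> R y -> R (x - y).
Proof. by case: sR => _ + _; exact. Qed.

Lemma subringM x y : R x -> R y -> R (x * y).
Proof. by case: sR => _ _; exact. Qed.

Lemma subring0 : R 0.
Proof. by rewrite -(subrr 1); apply: subringB subring1 subring1. Qed.

Lemma subringN x : R x -> R (- x).
Proof. by rewrite -sub0r; apply: subringB subring0. Qed.

Lemma subringD x y : R x -> R y -> R (x + y).
Proof.
by move=> Rx Ry; rewrite -[y]opprK; apply: subringB => //; apply: subringN.
Qed.

Lemma subringX x n : R x -> R (x ^+ n).
Proof.
move=> Rx; elim: n => [|n IH]; first exact: subring1.
by rewrite exprS; apply: subringM.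
Qed.

Lemma subring_nat n : R n%:R.
Proof.
elim: n => [|n IH]; first exact: subring0.
by rewrite mulrSr; apply: subringD subring1.
Qed.

Lemma subring_sum (I : Type) (r : seq I) (P : pred I) (F : I -> L) :
  (forall i, P i -> R (F i)) -> R (\sum_(i <- r | P i) F i).
Proof. by move=> RF; apply: big_ind => //; [exact: subring0 | exact: subringD]. Qed.

Definition coefs_in (q : {poly L}) := forall i, R q`_i.

Definition adjoin x : L -> Prop := fun y => exists2 q, coefs_in q & y = q.[x].

Lemma adjoin_subring x : subringP (adjoin x).
Proof.
split.
- exists 1; last by rewrite hornerC.
  by move=> i; rewrite coef1; exact: subring_nat.
- move=> _ _ [q Rq ->] [q' Rq' ->]; exists (q - q'); last by rewrite !hornerE.
  by move=> i; rewrite coefB; apply: subringB.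
- move=> _ _ [q Rq ->] [q' Rq' ->]; exists (q * q'); last by rewrite hornerM.
  by move=> i; rewrite coefM; apply: subring_sum => j _; apply: subringM.
Qed.

Lemma adjoin_base x y : R y -> adjoin x y.
Proof.
move=> Ry; exists y%:P; last by rewrite hornerC.
by move=> i; rewrite coefC; case: ifP => // _; exact: subring0.
Qed.

Lemma adjoin_gen x : adjoin x x.
Proof.
exists 'X; last by rewrite hornerX.
by move=> i; rewrite coefX; exact: subring_nat.
Qed.

End Subring.

Definition valuation_subring (L : fieldType) (R : L -> Prop) :=
  subringP R /\ forall x, R x \/ R x^-1.

Section MaximalSubring.
Variables (L : fieldType) (R : L -> Prop) (sR : subringP R) (p : L).
Hypotheses (p0 : p != 0) (Rp : R p) (RpV : ~ R p^-1).
Hypothesis maxR : forall x, ~ R x -> adjoin R x p^-1.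

(** If w = 1 - p b were not invertible in R, then p^-1 would be a polynomial in
w^-1. Clearing denominators puts some p^-1 w^k in R, and the exponent goes down
because p^-1 w^k = p^-1 w^(k+1) + b w^k. *)
Lemma maximal_unit b : R b -> 1 - p * b != 0 /\ R (1 - p * b)^-1.
Proof.
move=> Rb; set w := 1 - p * b.
have Rw : R w by apply: (subringB sR) (subring1 sR) (subringM sR _ _).
have w0 : w != 0.
  apply: contra_not_neq RpV => /subr0_eq pb1.
  by have -> : p^-1 = b by apply: (mulfI p0); rewrite divff.
split=> //; apply: contrapT => /maxR [q Rq eq].
have clear k : R (p^-1 * w ^+ k) -> R p^-1.
  elim: k => [|k IH]; first by rewrite mulr1.
  move=> Rk; apply: IH.
  have -> : p^-1 * w ^+ k = p^-1 * w ^+ k.+1 + b * w ^+ k.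
    by rewrite exprS /w; field.
  by apply: (subringD sR) => //; apply: (subringM sR) => //; apply: (subringX sR).
apply: RpV; apply: (clear (size q)); rewrite eq horner_coef mulr_suml.
apply: (subring_sum sR) => i _; rewrite -mulrA; apply: (subringM sR) => //.
have -> : w^-1 ^+ i * w ^+ size q = w ^+ (size q - i).
  rewrite exprVn -[in w ^+ size q](subnK (ltnW (ltn_ord i))) exprD.
  by rewrite mulrCA mulVf ?mulr1 ?expf_neq0.
exact: (subringX sR).
Qed.

(** If p^-1 is polynomial in x and in y = x^-1, the longer expression can be
shortened. In 1 = p b(y) the factor 1 - p b_0 is invertible, so 1 is a
combination of positive powers of y, and x^m a combination of lower powers of x;
this replaces the leading term of a. *)
Lemma maximal_no_relations n (a b : {poly L}) x y :
  (size a + size b <= n)%N -> x * y = 1 -> coefs_in R a -> coefs_in R b ->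
  p^-1 = a.[x] -> p^-1 = b.[y] -> False.
Proof.
elim: n a b x y => [|n IH] a b x y.
  rewrite leqn0 addn_eq0 => /andP[/eqP a0 _] _ _ _ ea _.
  have := invr_eq0 p; rewrite ea; move/eqP: a0; rewrite size_poly_eq0 => /eqP ->.
  by rewrite horner0 eqxx (negPf p0).
move=> sab xy1 Ra Rb ea eb.
wlog sba : a b x y sab xy1 Ra Rb ea eb / (size b <= size a)%N.
  move=> W; case/orP: (leq_total (size b) (size a)) => s; first exact: (W a b x y).
  by apply: (W b a y x) => //; rewrite 1?addnC 1?mulrC.
have a0 : a != 0.
  apply: contra_eq_neq ea => ->; rewrite horner0 invr_eq0.
  exact: p0.
have [Rw0 Ru] := maximal_unit (Rb 0%N); set u := (_ - _)^-1 in Ru.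
case sa : (size a) => [|m]; first by move/eqP: sa; rewrite size_poly_eq0 (negPf a0).
have b_rel : 1 = \sum_(1 <= j < size b) u * p * b`_j * y ^+ j.
  have sb : (0 < size b)%N.
    rewrite lt0n size_poly_eq0; apply: contra_eq_neq eb => ->.
    by rewrite horner0 invr_eq0.
  transitivity (u * (1 - p * b`_0)); first by rewrite mulVf.
  have -> : 1 - p * b`_0 = p * \sum_(1 <= j < size b) b`_j * y ^+ j.
    rewrite -(divff p0) eb horner_coef.
    rewrite -(big_mkord xpredT (fun i => b`_i * y ^+ i)) big_ltn //.
    by rewrite expr0 mulr1 mulrDr addrC addKr.
  by rewrite !mulr_sumr; apply: eq_bigr => i _; rewrite !mulrA.
pose r := \sum_(1 <= j < size b) (u * p * b`_j) *: 'X^(m - j).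
have rx : r.[x] = x ^+ m.
  rewrite -[RHS]mul1r b_rel mulr_suml /r horner_sum.
  apply: eq_big_nat => j /andP[_ jb].
  have jm : (j <= m)%N by rewrite -ltnS -sa (leq_trans jb).
  rewrite hornerZ hornerXn -!mulrA; do 3!congr (_ * _).
  by rewrite -{2}(subnKC jm) exprD mulrA -exprMn [y * x]mulrC xy1 expr1n mul1r.
pose a' := a - a`_m *: 'X^m + a`_m *: r.
have sr : (size r <= m)%N.
  apply: (leq_trans (size_sum _ _ _)); apply/bigmax_leqP_seq => j.
  rewrite mem_index_iota => /andP[j1 jb] _.
  rewrite (leq_trans (size_scale_leq _ _)) // size_polyXn ltn_subrL.
  by rewrite j1 (leq_trans j1) // -ltnS -sa (leq_trans jb).
have sa' : (size a' <= m)%N.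
  rewrite (leq_trans (size_polyD _ _)) // geq_max.
  rewrite (leq_trans (size_scale_leq _ _) sr) andbT; apply/leq_sizeP => j mj.
  rewrite coefB coefZ coefXn.
  have [->|jm] := eqVneq j m; first by rewrite mulr1 subrr.
  by rewrite mulr0 subr0 nth_default // sa ltn_neqAle eq_sym jm.
apply: (IH a' b x y) => //.
- by rewrite -ltnS (leq_trans _ sab) // sa addSn ltnS leq_add2r.
- move=> i; rewrite /a' coefD coefB !coefZ coefXn; apply: (subringD sR).
    by apply: (subringB sR) => //; apply: (subringM sR) => //; exact: subring_nat.
  apply: (subringM sR) => //; rewrite coef_sum; apply: (subring_sum sR) => j _.
  rewrite coefZ coefXn; apply: (subringM sR); last exact: subring_nat.
  by apply: (subringM sR) => //; apply: (subringM sR).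
- by rewrite /a' !hornerE rx subrK.
Qed.

Lemma maximal_valuation_subring : valuation_subring R.
Proof.
split=> // x; apply: contrapT => /not_orP[nx nxV].
have [a Ra ea] := maxR nx; have [b Rb eb] := maxR nxV.
have x0 : x != 0 by apply: contra_not_neq nx => ->; exact: subring0.
by apply: (maximal_no_relations (leqnn _) _ Ra Rb ea eb); rewrite divff.
Qed.

End MaximalSubring.

(** Chevalley's extension theorem: a subring that contains O and is maximal
among those without p^-1 is a valuation subring, because adjoining any element
outside it produces p^-1. *)
Theorem exists_valuation_subring (L : fieldType) (O : L -> Prop) (p : L) :
  subringP O -> p != 0 -> O p -> ~ O p^-1 ->
  exists R : L -> Prop, [/\ valuation_subring R, forall x, O x -> R x & ~ R p^-1].
Proof.
move=> sO p0 Op OpV.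
pose good (A : L -> Prop) := [/\ subringP A, forall x, O x -> A x & ~ A p^-1].
(* The empty set is admitted for the sake of the empty chain. *)
pose P (A : set L) := A = set0 \/ good A.
have Pnon A x : P A -> A x -> good A by case=> // -> [].
have [F FP totF|R [PR maxR]] := @Zorn_bigcup L P.
  have [[A [x [FA Ax]]]|none] := pselect (exists A x, F A /\ A x); last first.
    left; apply/seteqP; split=> // x [A FA Ax]; apply: none; by exists A, x.
  right.
  have [sA OA ApV] := Pnon _ _ (FP _ FA) Ax.
  have two B C y z : F B -> F C -> B y -> C z ->
     exists D, [/\ F D, good D, D y & D z].
    move=> FB FC By Cz; have [BC|CB] := totF _ _ FB FC.
      by exists C; split=> //; [exact: (Pnon _ z (FP _ FC))|exact: BC].
    by exists B; split=> //; [exact: (Pnon _ y (FP _ FB))|exact: CB].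
  split.
  - split.
    + by exists A => //; exact: subring1.
    + move=> y z [B FB By] [C FC Cz].
      have [D [FD [sD _ _] Dy Dz]] := two _ _ _ _ FB FC By Cz.
      by exists D => //; exact: (subringB sD).
    + move=> y z [B FB By] [C FC Cz].
      have [D [FD [sD _ _] Dy Dz]] := two _ _ _ _ FB FC By Cz.
      by exists D => //; exact: (subringM sD).
  - by move=> y Oy; exists A => //; exact: OA.
  - by move=> [B FB BpV]; have [_ _] := Pnon _ _ (FP _ FB) BpV.
have gR : good R.
  case: PR => // R0; case: (maxR O); last by right; split.
  rewrite R0; split=> // h; exact: (h 1 (subring1 sO)).
have [sR OR RpV] := gR.
exists R; split=> //.
apply: (@maximal_valuation_subring L R sR p p0 (OR _ Op) RpV) => x nRx.
apply: contrapT => npV; apply: (maxR (adjoin R x)); last first.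
  right; split=> //; first exact: adjoin_subring.
  by move=> y Oy; apply: (adjoin_base sR); exact: OR.
split; first by move=> y Ry; exact: adjoin_base.
by move=> h; apply: nRx; exact: h _ (adjoin_gen sR x).
Qed.

(** * Extending a discrete valuation to a finite extension *)

Section ValuationSubring.
Variables (L : fieldType) (R : L -> Prop) (vR : valuation_subring R).
Let sR : subringP R := proj1 vR.

Lemma valuation_total x : R x \/ R x^-1. Proof. exact: (proj2 vR). Qed.

Definition units_of : L -> Prop := fun x => [/\ x != 0, R x & R x^-1].
Definition nonunits_of : L -> Prop := fun x => x = 0 \/ R x /\ ~ R x^-1.

Lemma unitsM x y : units_of x -> units_of y -> units_of (x * y).
Proof.
move=> [x0 Rx RxV] [y0 Ry RyV]; split; rewrite ?mulf_neq0 ?invfM //;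
  exact: (subringM sR).
Qed.

Lemma unitsV x : units_of x -> units_of x^-1.
Proof. by move=> [x0 Rx RxV]; split; rewrite ?invr_eq0 ?invrK. Qed.

Lemma unitsX x n : units_of x -> units_of (x ^+ n).
Proof.
move=> [x0 Rx RxV]; split; rewrite -?exprVn ?expf_neq0 //; exact: (subringX sR).
Qed.

Lemma nonunits_sub x : nonunits_of x -> R x.
Proof. by case=> [->|[]//]; exact: (subring0 sR). Qed.

Lemma not_nonunits x : R x -> ~ nonunits_of x -> units_of x.
Proof.
move=> Rx nx; split=> //; first by apply: contra_not_neq nx => ->; left.
by apply: contrapT => nR; apply: nx; right.
Qed.

Lemma units_not_nonunits x : units_of x -> ~ nonunits_of x.
Proof. by move=> [x0 _ RV] [xE|[_ /(_ RV)]//]; rewrite xE eqxx in x0. Qed.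

(** One of y/x and x/y lies in R, say the first. If x + y were a unit then 1/x =
(1 + y/x) / (x + y) would lie in R. *)
Lemma nonunitsD x y : nonunits_of x -> nonunits_of y -> nonunits_of (x + y).
Proof.
case=> [->|nx]; first by rewrite add0r.
case=> [->|ny]; first by rewrite addr0; right.
wlog Rq : x y nx ny / R (y / x).
  move=> W; case: (valuation_total (y / x)) => h; first exact: W.
  by rewrite addrC; apply: W => //; rewrite invf_div in h.
have [-> | s0] := eqVneq (x + y) 0; [by left | right].
have x0 : x != 0.
  apply/eqP => x0; case: nx => _; apply; rewrite x0 invr0; exact: (subring0 sR).
split; first by apply: (subringD sR); [case: nx|case: ny].
move=> RV; case: nx => _; apply.
have -> : x^-1 = (1 + y / x) * (x + y)^-1 by field; rewrite ?x0 ?s0.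
by apply: (subringM sR) => //; apply: (subringD sR) => //; exact: (subring1 sR).
Qed.

Lemma nonunitsM x y : nonunits_of x -> R y -> nonunits_of (x * y).
Proof.
move=> nx Ry; apply: contrapT => /not_nonunits U.
have Rx := nonunits_sub nx.
have [xy0 _ RV] := U (subringM sR Rx Ry).
case: nx => [x0|[_]]; first by rewrite x0 mul0r eqxx in xy0.
apply; have -> : x^-1 = y * (x * y)^-1.
  by move: xy0; rewrite mulf_eq0 => /norP[x0 y0]; field; rewrite ?x0 ?y0.
exact: (subringM sR).
Qed.

Lemma units1 : units_of 1.
Proof. by split; rewrite ?oner_neq0 ?invr1 //; exact: (subring1 sR). Qed.

Lemma units1B x : nonunits_of x -> units_of (1 - x).
Proof.
move=> nx; apply: not_nonunits.
  by apply: (subringB sR); [exact: (subring1 sR)|exact: nonunits_sub].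
move=> n1; apply: (units_not_nonunits units1).
by rewrite -(subrK x 1); exact: nonunitsD.
Qed.

Lemma valuation_root x n : (0 < n)%N -> R (x ^+ n) -> R x.
Proof.
case: n => // n _ Rxn; case: (valuation_total x) => // RV.
have [->|x0] := eqVneq x 0; first exact: (subring0 sR).
have -> : x = x ^+ n.+1 * x^-1 ^+ n.
  by rewrite exprS -mulrA -exprMn divff ?expr1n ?mulr1.
by apply: (subringM sR) => //; exact: (subringX sR).
Qed.

Lemma valuation_sqrt x c0 : R c0 -> x ^+ 2 = c0 -> R x.
Proof. by move=> R0 e; apply: (@valuation_root x 2) => //; rewrite e. Qed.

(** If x were not in R, dividing the equation by x^2 would express x by elements
of R, since x^-1 lies in R. *)
Lemma valuation_cubic x c2 c1 c0 : R c2 -> R c1 -> R c0 ->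
  x ^+ 3 = c2 * x ^+ 2 + c1 * x + c0 -> R x.
Proof.
move=> R2 R1 R0 e; case: (valuation_total x) => // RV.
have [->|x0] := eqVneq x 0; first exact: (subring0 sR).
have -> : x = c2 + c1 * x^-1 + c0 * x^-1 ^+ 2.
  have {1}-> : x = x ^+ 3 / x ^+ 2 by field.
  by rewrite e; field.
by do ![apply: (subringD sR) | apply: (subringM sR) | apply: (subringX sR)].
Qed.

(** Divisibility in R is a total preorder, so a finite family has an element of
least value. *)
Lemma dominant_element (s : seq L) : has (fun x => x != 0) s ->
  exists2 k, k \in s & k != 0 /\ forall x, x \in s -> R (x / k).
Proof.
elim: s => //= a s IH; have [->|a0 _] := eqVneq a 0.
  move=> /IH [k ks [k0 Rk]]; exists k; first by rewrite inE ks orbT.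
  split=> // x; rewrite inE => /predU1P[->|/Rk//].
  by rewrite mul0r; exact: (subring0 sR).
have self : R (a / a) by rewrite divff //; exact: (subring1 sR).
have [/IH [k ks [k0 Rk]]|/hasPn ns] := boolP (has (fun x => x != 0) s); last first.
  exists a; first by rewrite mem_head.
  split=> // x; rewrite inE => /predU1P[->//|/ns/negPn/eqP->].
  by rewrite mul0r; exact: (subring0 sR).
case: (valuation_total (a / k)) => h.
  exists k; first by rewrite inE ks orbT.
  by split=> // x; rewrite inE => /predU1P[->|/Rk//].
exists a; first by rewrite mem_head.
split=> // x; rewrite inE => /predU1P[->//|/Rk Rx].
have -> : x / a = (x / k) * (a / k)^-1 by field; rewrite a0 k0.
exact: (subringM sR).
Qed.

(** Otherwise dividing by a term of least value would write -1 as a sum of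
nonunits. *)
Lemma zero_sum_units n (t : 'I_n -> L) : \sum_i t i = 0 ->
  (exists i, t i != 0) -> exists i j, [/\ i != j, t j != 0 & units_of (t i / t j)].
Proof.
move=> t0 [i0 ti0].
have [|_ /codomP[k ->] [k0 Rk]] := @dominant_element (codom t).
  by apply/hasP; exists (t i0) => //; exact: codom_f.
apply: contrapT => none; apply: (units_not_nonunits (x := -1)).
  split; rewrite ?oppr_eq0 ?oner_neq0 ?invrN1 //;
    by apply: (subringN sR); exact: (subring1 sR).
have -> : -1 = \sum_(i | i != k) t i / t k.
  apply/esym/eqP; rewrite -addr_eq0 -mulr_suml.
  rewrite -[X in _ + X](divff k0) -mulrDl addrC.
  by move: t0; rewrite (bigD1 k) //= => ->; rewrite mul0r.
apply: (big_ind nonunits_of); [by left|exact: nonunitsD|] => i ik.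
apply: contrapT => nu; apply: none; exists i, k; split=> //.
by apply: not_nonunits => //; apply: Rk; exact: codom_f.
Qed.

End ValuationSubring.

Section Extension.
Variables (K : fieldType) (v : dvaluation K) (L : fieldExtType K).
Variables (R : L -> Prop) (vR : valuation_subring R).
Hypothesis RK : forall x : K, R x%:A <-> vge v 0 x.
Let sR : subringP R := proj1 vR.
Local Notation U := (units_of R).

Lemma units_alg (c : K) : c != 0 -> U (c%:A) <-> v c = 0.
Proof.
move=> c0; have cA0 : c%:A != 0 :> L by rewrite scaler_eq0 oner_eq0 orbF.
have cV : (c%:A : L)^-1 = (c^-1)%:A by rewrite -in_algE -fmorphV.
have geE a : a != 0 -> vge v 0 a = (0 <= v a) by rewrite /vge => /negPf->.
split=> [[_ /RK + ]|vc].
  rewrite cV geE // => vc /RK; rewrite geE ?invr_eq0 // dvalV // oppr_ge0 => vc'.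
  by apply/eqP; rewrite eq_le vc' vc.
by split=> //; [apply/RK|rewrite cV; apply/RK];
  rewrite geE ?invr_eq0 ?dvalV ?vc ?oppr0.
Qed.

Let n := \dim {:L}.
(* For each x some power x^k, with 0 < k <= n, has the value of a scalar; e is a
   common multiple of these exponents. *)
Let e := n`!.

(** The n + 1 powers of x are linearly dependent over K. Two terms of a linear
relation have the same value, so the quotient of two powers of x is the product
of a scalar by a unit. *)
Lemma exists_power_associate x : x != 0 ->
  exists k c, [/\ (0 < k <= n)%N, c != 0 & U (x ^+ k / (c%:A : L))].
Proof.
move=> x0; pose X := [tuple x ^+ i | i < n.+1].
have nfree : ~~ free X.
  by rewrite /free size_tuple neq_ltn ltnS dimvS ?subvf.
have [c cE [i ci]] : exists2 c : 'I_n.+1 -> K, \sum_i c i *: X`_i = 0 &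
    exists i, c i != 0.
  apply: contrapT => none; move/negP: nfree; apply; apply/freeP => c cE i.
  by apply: contrapT => /eqP ci; apply: none; exists c => //; exists i.
have cE' : \sum_(i < n.+1) c i *: x ^+ i = 0.
  by rewrite -[RHS]cE; apply: eq_bigr => j _; rewrite -tnth_nth tnth_mktuple.
have [|i' [j' [ij tj0 Uij]]] := zero_sum_units vR cE'.
  by exists i; rewrite scaler_eq0 negb_or ci expf_neq0.
have ti0 : c i' *: x ^+ i' != 0.
  by case: Uij; rewrite mulf_eq0 => /norP[].
wlog lt : i' j' ij tj0 ti0 Uij / (j' < i')%N.
  move=> W; case/orP: (leq_total j' i') => h.
    by apply: (W i' j') => //; rewrite ltn_neqAle h andbT eq_sym.
  apply: (W j' i') => //; first by rewrite eq_sym.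
    by rewrite -invf_div; apply: unitsV.
  by rewrite ltn_neqAle h andbT.
have ci0 : c i' != 0 by move: ti0; rewrite scaler_eq0 => /norP[].
have cj0 : c j' != 0 by move: tj0; rewrite scaler_eq0 => /norP[].
exists (i' - j')%N, (c j' / c i'); split.
- by rewrite subn_gt0 lt (leq_trans (leq_subr _ _)) // -ltnS.
- by rewrite mulf_neq0 ?invr_eq0.
move: Uij; congr (units_of R _).
rewrite -[c i' *: _]mulr_algl -[c j' *: _]mulr_algl -!in_algE fmorph_div /=.
rewrite -{1}(subnK (ltnW lt)) exprD.
by field; rewrite expf_neq0 // !scaler_eq0 !oner_eq0 !orbF ci0 cj0.
Qed.

Lemma exists_rational_value x : x != 0 ->
  exists m, exists2 c, c != 0 & v c = m /\ U (x ^+ e / (c%:A : L)).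
Proof.
move=> x0; have [k [c [/andP[k0 kn] c0 Uk]]] := exists_power_associate x0.
have ke : (k %| e)%N by rewrite dvdn_fact // k0.
exists (v (c ^+ (e %/ k))), (c ^+ (e %/ k)); first by rewrite expf_neq0.
split=> //; rewrite -{1}(divnK ke) mulnC exprM -in_algE rmorphXn /= -expr_div_n.
exact: unitsX.
Qed.

Lemma rational_value_unique x m m' c c' : c != 0 -> c' != 0 ->
  v c = m -> v c' = m' -> U (x / (c%:A : L)) -> U (x / (c'%:A : L)) -> m = m'.
Proof.
move=> c0 c'0 <- <- Uc Uc'.
have cA0 : c%:A != 0 :> L by rewrite scaler_eq0 oner_eq0 orbF.
have c'A0 : c'%:A != 0 :> L by rewrite scaler_eq0 oner_eq0 orbF.
have x0 : x != 0 by case: Uc; rewrite mulf_eq0 => /norP[].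
have : U ((c / c')%:A).
  have -> : (c / c')%:A = (x / c'%:A) * (x / c%:A)^-1 :> L.
    by rewrite -!in_algE fmorph_div /=; field; rewrite x0 cA0 c'A0.
  by apply: unitsM => //; apply: unitsV.
move/units_alg; rewrite mulf_neq0 ?invr_eq0 // => /(_ isT).
by rewrite dvalM ?invr_eq0 // dvalV // => /subr0_eq.
Qed.

(** The number w0 x is the value of a scalar that differs from x^e by a unit.
This is a homomorphism to the integers, nonnegative exactly on R and equal to e
v on K. Dividing by the positive generator d of its image makes it surjective.
*)
Theorem extend_dvaluation :
  exists2 w : dvaluation L, dval_extends v w & forall x, vge w 0 x <-> R x.
Proof.
have /choice[w0 w0P] : forall x : L, exists m, x != 0 ->
    exists2 c, c != 0 & v c = m /\ U (x ^+ e / (c%:A : L)).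
  move=> x; have [->|x0] := eqVneq x 0; first by exists 0.
  by have [m mP] := exists_rational_value x0; exists m.
have w0E x m c : x != 0 -> c != 0 -> v c = m -> U (x ^+ e / (c%:A : L)) -> w0 x = m.
  move=> x0 c0 vc Uc; have [c' c'0 [vc' Uc']] := w0P x x0.
  exact: (rational_value_unique c'0 c0 vc' vc Uc' Uc).
have w0M x y : x != 0 -> y != 0 -> w0 (x * y) = w0 x + w0 y.
  move=> x0 y0; have [c c0 [vc Uc]] := w0P x x0; have [d d0 [vd Ud]] := w0P y y0.
  apply: (w0E _ _ (c * d)); rewrite ?mulf_neq0 //; first by rewrite dvalM // vc vd.
  rewrite exprMn -in_algE rmorphM /= -mulf_div; exact: unitsM.
have w0K c : c != 0 -> w0 (c%:A) = v c *+ e.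
  move=> c0; have cA0 : c%:A != 0 :> L by rewrite scaler_eq0 oner_eq0 orbF.
  apply: (w0E _ _ (c ^+ e)); rewrite ?expf_neq0 //.
    elim: (e) => [|k IH]; first by rewrite expr0 dval1 mulr0n.
    by rewrite exprS dvalM ?expf_neq0 // IH mulrS.
  rewrite -!in_algE rmorphXn divff ?expf_neq0 //; exact: units1.
have w0_ge0 x : x != 0 -> (0 <= w0 x) <-> R x.
  move=> x0; have [c c0 [vc Uc]] := w0P x x0.
  have cA0 : c%:A != 0 :> L by rewrite scaler_eq0 oner_eq0 orbF.
  have vcE : vge v 0 c = (0 <= w0 x) by rewrite /vge (negPf c0) vc.
  rewrite -vcE -RK; split=> [Rc|Rx].
    apply: (valuation_root vR (fact_gt0 n)); rewrite -(divfK cA0 (x ^+ e)).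
    by apply: (subringM sR) => //; case: Uc.
  have -> : c%:A = x ^+ e * (x ^+ e / c%:A)^-1.
    by field; rewrite cA0 expf_neq0.
  by apply: (subringM sR); [exact: (subringX sR)|case: Uc].
have w01 : w0 1 = 0.
  by apply: (addrI (w0 1)); rewrite -w0M ?oner_neq0 // mulr1 addr0.
have w0V x : x != 0 -> w0 x^-1 = - w0 x.
  by move=> x0; apply/eqP; rewrite -addr_eq0 -w0M ?invr_eq0 // mulVf // w01.
have w0X x k : x != 0 -> w0 (x ^+ k) = w0 x *+ k.
  move=> x0; elim: k => [|k IH]; first by rewrite expr0 w01.
  by rewrite exprS w0M ?expf_neq0 // IH mulrS.
have w0Xz x (k : int) : x != 0 -> exists2 y, y != 0 & w0 y = k * w0 x.
  move=> x0; case: k => k.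
    exists (x ^+ k); first by rewrite expf_neq0.
    by rewrite w0X // -[Posz k]natz mulr_natl.
  exists (x ^+ k.+1)^-1; first by rewrite invr_eq0 expf_neq0.
  by rewrite w0V ?expf_neq0 // w0X // NegzE mulNr -[Posz k.+1]natz mulr_natl.
pose S (d : nat) := `[< (0 < d)%N /\ exists2 y, y != 0 & w0 y = d%:Z >].
have Sex : exists d, S d.
  have [p p0 vp] := dval_onto v 1; exists e; apply/asboolP.
  split; first exact: fact_gt0.
  exists (p%:A); first by rewrite scaler_eq0 oner_eq0 orbF.
  by rewrite w0K // vp natz.
have [d /asboolP[d0 [y0 y00 vy0]] dmin] := ex_minnP Sex.
have dz0 : d%:Z != 0 by rewrite eqz_nat -lt0n.
have dz_gt0 : 0 < d%:Z by rewrite ltz_nat.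
have dvd x : x != 0 -> (d %| w0 x)%Z.
  move=> x0; apply/dvdz_mod0P; have [z z0 vz] := w0Xz y0 (w0 x %/ d)%Z y00.
  (* The remainder is itself a value, smaller than d, hence zero. *)
  have vr : w0 (x / z) = (w0 x %% d)%Z.
    rewrite w0M ?invr_eq0 // w0V // vz vy0 {1}(divz_eq (w0 x) d).
    by rewrite addrAC subrr add0r.
  have := modz_ge0 (w0 x) dz0; have := ltz_pmod (w0 x) dz_gt0.
  rewrite -vr; case E : (w0 (x / z)) => [[|r]|r] //= rd _.
  have : S r.+1.
    by apply/asboolP; split=> //; exists (x / z); rewrite ?mulf_neq0 ?invr_eq0.
  by move/dmin; rewrite leqNgt -ltz_nat rd.
pose w x := (w0 x %/ d)%Z.
have wK x : x != 0 -> w x * d = w0 x by move=> /dvd; exact: divzK.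
have wM x y : x != 0 -> y != 0 -> w (x * y) = w x + w y.
  by move=> x0 y0'; apply: (mulIf dz0); rewrite mulrDl !wK ?mulf_neq0 ?w0M.
have w_ge0 x : x != 0 -> (0 <= w x) <-> R x.
  by move=> x0; rewrite -w0_ge0 // -(wK x x0) pmulr_lge0.
have wV x : x != 0 -> w x^-1 = - w x.
  by move=> x0; apply: (mulIf dz0); rewrite mulNr !wK ?invr_eq0 // w0V.
have wD x y : x != 0 -> y != 0 -> x + y != 0 -> Num.min (w x) (w y) <= w (x + y).
  move=> x0 y1 s0.
  have le a b : a != 0 -> a + b != 0 -> R (b / a) -> w a <= w (a + b).
    move=> a0 s Rba; rewrite -subr_ge0 -wV // -wM ?invr_eq0 //.
    apply/w_ge0; first by rewrite mulf_neq0 ?invr_eq0.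
    rewrite mulrDl divff //; apply: (subringD sR) => //; exact: (subring1 sR).
  rewrite ge_min; case: (valuation_total vR (y / x)) => h.
    by rewrite (le x y).
  by rewrite addrC (le y x) ?orbT // 1?addrC // -invf_div.
have w_onto (k : int) : exists2 x, x != 0 & w x = k.
  have [z z0 vz] := w0Xz y0 k y00; exists z => //.
  by rewrite /w vz vy0 mulzK.
exists (DValuation wM wD w_onto); last first.
  move=> x; rewrite /vge /=; have [->|x0 /=] := eqVneq x 0; last exact: w_ge0.
  by split=> // _; exact: (subring0 sR).
have [p p0 vp] := dval_onto v 1.
have pA0 : p%:A != 0 :> L by rewrite scaler_eq0 oner_eq0 orbF.
have ede : w (p%:A) * d = e by rewrite wK // w0K // vp natz.
have wp_gt0 : 0 < w p%:A by rewrite -(pmulr_lgt0 _ dz_gt0) ede ltz_nat fact_gt0.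
exists `|w p%:A|%N; first by rewrite absz_gt0 gt_eqF.
move=> x x0 /=; have xA0 : x%:A != 0 :> L by rewrite scaler_eq0 oner_eq0 orbF.
have mulrn_int (a : int) k : a *+ k = a * k%:Z by rewrite -mulr_natr natz.
apply: (mulIf dz0); rewrite wK // w0K // !mulrn_int -ede gtz0_abs //.
by rewrite mulrA mulrAC -mulrA.
Qed.

End Extension.

(** * Finite subextensions *)

(** The elements are adjoined one at a time. A nonzero polynomial of least size
over L that vanishes at c is irreducible, and yields the next extension as an
extension of L, which is then regarded as an extension of K. *)
Lemma exists_finite_subextension (K : fieldType) (C : fieldType)
    (iota : {rmorphism K -> C}) (s : seq C) :
  (forall x, x \in s -> algebraicOver iota x) ->
  exists (L : fieldExtType K) (j : {rmorphism L -> C}),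
    (forall x : K, j x%:A = iota x) /\ (forall c, c \in s -> exists l, j l = c).
Proof.
elim: s => [|c s IH] alg.
  exists (K^o : fieldExtType K), iota; split=> // x.
  by rewrite [x%:A]mulr1.
have [x sx|L [j [jK js]]] := IH; first by apply: alg; rewrite inE sx orbT.
pose rt (q : {poly L}) := (q != 0) && root (map_poly j q) c.
have [p p0 pc] := alg c (mem_head _ _).
have rtp : rt (map_poly (in_alg L) p).
  rewrite /rt map_poly_eq0 p0 -map_poly_comp /=.
  by rewrite (eq_map_poly (g := iota)) // => x /=; rewrite jK.
have ex : exists m, `[< exists2 q, rt q & size q = m :> nat >].
  exists (size (map_poly (in_alg L) p)); apply/asboolP.
  by exists (map_poly (in_alg L) p).
have [m /asboolP[q /andP[q0 qc] sq] qmin] := ex_minnP ex.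
have irr : irreducible_poly q.
  apply/(subfx_irreducibleP qc q0) => r rc r0.
  by rewrite sq; apply: qmin; apply/asboolP; exists r; rewrite // /rt r0.
pose E : fieldExtType L := SubFieldExtType qc irr.
pose j' : {rmorphism E -> C} := subfx_inj (iota := j) (z := c) (p := q).
have j'L x : j' x%:A = j x by exact: subfx_inj_base.
exists (baseFieldType E : fieldExtType K), j'; split=> [x|d].
  by rewrite [x%:A]baseField_scaleE; rewrite -jK -j'L.
rewrite inE => /predU1P[->|/js[l jl]]; last by exists (l%:A : E); rewrite j'L.
by exists (subfx_root j c q); exact: subfx_inj_root.
Qed.

(** * Good reduction and the resultant *)

Definition qall (T : Type) (P : T -> Prop) (q : quadpair T) : Prop :=
  let: QuadPair a2 a1 a0 b2 b1 b0 := q in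
  [/\ P a2, P a1 & P a0] /\ [/\ P b2, P b1 & P b0].

Lemma qmap_comp (R S T : Type) (g : S -> T) (f : R -> S) q :
  qmap g (qmap f q) = qmap (g \o f) q.
Proof. by case: q. Qed.

Lemma qmap_id_on (T : Type) (P : T -> Prop) (f : T -> T) q :
  qall P q -> (forall x, P x -> f x = x) -> qmap f q = q.
Proof. by case: q => a b c d e g [[? ? ?] [? ? ?]] fP /=; rewrite !fP. Qed.

Lemma map_polyM (R S : nzRingType) (h : {rmorphism R -> S}) (p q : {poly R}) :
  map_poly h (p * q) = map_poly h p * map_poly h q.
Proof. exact: rmorphM. Qed.

Lemma map_scaled_qnum (R S : comNzRingType) (h : {rmorphism R -> S}) t p q :
  map_poly h (t *: (p * qnum q)) = qnum (qmap h q) * (h t *: map_poly h p).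
Proof. by rewrite map_polyZ map_polyM qnum_map scalerAl mulrC. Qed.

Lemma map_scaled_qden (R S : comNzRingType) (h : {rmorphism R -> S}) t p q :
  map_poly h (t *: (p * qden q)) = qden (qmap h q) * (h t *: map_poly h p).
Proof. by rewrite map_polyZ map_polyM qden_map scalerAl mulrC. Qed.

Section GoodReduction.
Variables (K : fieldType) (w : dvaluation K).
Local Notation O := (valring w).
Local Notation rho := (@residue_map K w).
Implicit Types q : quadpair O.

Lemma vge_valuation_subring : valuation_subring (fun x => vge w 0 x).
Proof.
split; first split.
- by rewrite /vge dval1 lexx orbT.
- by move=> x y wx wy; rewrite vgeD ?vgeN.
- by move=> x y wx wy; rewrite -[0]addr0 vgeM.
move=> x; rewrite /vge; have [->|x0] := eqVneq x 0; first by left.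
rewrite invr_eq0 (negPf x0) dvalV // oppr_ge0 /=.
by apply/orP; exact: le_total.
Qed.

Definition to_valring : K -> O := insubd (0 : O).

Lemma to_valringK x : vge w 0 x -> val (to_valring x) = x.
Proof. by move=> wx; rewrite insubdK. Qed.

Lemma to_valring0 : to_valring 0 = 0.
Proof. by apply: val_inj; rewrite to_valringK ?vge0 // rmorph0. Qed.

Lemma map_to_valring (p : {poly K}) : (forall i, vge w 0 p`_i) ->
  map_poly val (map_poly to_valring p) = p.
Proof.
move=> wp; apply/polyP => i.
by rewrite coef_map coef_map_id0 ?to_valring0 //= to_valringK.
Qed.

Lemma map_val_to_valringZ (a : K) (p : {poly O}) : vge w 0 a ->
  map_poly val (to_valring a *: p) = a *: map_poly val p.
Proof. by move=> wa; rewrite -{2}(to_valringK wa); exact: map_polyZ. Qed.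

Lemma map_rhoZ (x : O) (p : {poly O}) :
  map_poly rho (x *: p) = rho x *: map_poly rho p.
Proof. exact: map_polyZ. Qed.

Lemma val_map_inj : injective (map_poly (val : O -> K)).
Proof. by apply: map_inj_poly; [exact: val_inj | exact: rmorph0]. Qed.

Lemma residue_neq0 (x : O) : rho x != 0 -> val x != 0 /\ vge w 0 (val x)^-1.
Proof.
rewrite residue_map_eq0 /vge negb_or => /andP[x0]; rewrite -ltNge => vx.
rewrite x0 invr_eq0 (negPf x0) dvalV //= oppr_ge0; split=> //.
Qed.

(** Both x and x^-1 being integral, the value of x is 0. *)
Lemma residue_neq0_unit (x : O) : val x != 0 -> vge w 0 (val x)^-1 -> rho x != 0.
Proof.
move=> x0; rewrite residue_map_eq0 /vge invr_eq0 (negPf x0) /= dvalV //.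
by rewrite oppr_ge0 -ltNge => /le_lt_trans->.
Qed.

(** The pair is its own integral model. The residue of the resultant being
nonzero, one of the leading coefficients has nonzero residue, and the reduced
pair still defines a map of degree 2. *)
Lemma good_reduction_qratfun q : rho (qres q) != 0 ->
  good_reduction w (qratfun (qmap val q)).
Proof.
move=> rq; have rv : qres (qmap val q) != 0.
  by rewrite qres_map; case: (residue_neq0 rq).
have rr : qres (qmap rho q) != 0 by rewrite qres_map.
exists (qnum q), (qden q); split.
- apply: contraNneq (qden_neq0 rv) => G0.
  by rewrite -qden_map G0 rmorph0.
- by rewrite qnum_map qden_map.
- have unit (x : O) : rho x != 0 -> (val x != 0) && (w (val x) == 0).
    move=> rx; have [x0] := residue_neq0 rx; rewrite x0 /= /vge invr_eq0.
    rewrite (negPf x0) dvalV //= oppr_ge0 => le0; rewrite eq_le le0 /=.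
    by have := valP x; rewrite /vge (negPf x0).
  have mem (a b c : O) : rho a != 0 -> a \in (quad a b c : seq O).
    move=> ra; rewrite -[X in X \in _]/([:: c; b; a]`_2) -coef_quad mem_nth //.
    rewrite ltnNge; apply: contra ra => s2.
    by rewrite -[a]/([:: c; b; a]`_2) -(coef_quad a b c) nth_default // rmorph0.
  case: (q) (qres_lead rr) => a2 a1 a0 b2 b1 b0 /=.
  case/orP => ra; [exists a2|exists b2]; rewrite ?unit //; apply/orP.
    by left; exact: mem.
  by right; exact: mem.
by rewrite !qnum_map !qden_map -!/(qratfun _) !rdeg_qratfun.
Qed.

Lemma scale_to_primitive (s : seq K) : has (fun x => x != 0) s ->
  exists2 k, k != 0 & (forall x, x \in s -> vge w 0 (k^-1 * x)) /\
                      exists2 x, x \in s & k^-1 * x = 1.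
Proof.
move=> /(dominant_element vge_valuation_subring) [k ks [k0 wk]].
exists k => //; split; first by move=> x /wk; rewrite mulrC.
by exists k; rewrite ?mulVf.
Qed.

Lemma rdeg0_neq2 (k : fieldType) : rdeg (0 : ratfun k) <> 2%N.
Proof.
move=> /rdeg2_qratfun[q /esym/eqP + r0]; rewrite mulf_eq0 invr_eq0 !tofrac_eq0.
rewrite (negPf (qden_neq0 r0)) orbF; case: q r0 => a2 a1 a0 b2 b1 b0.
rewrite quad_eq0 /qres /= => /[swap] /and3P[/eqP-> /eqP-> /eqP->].
by rewrite !mul0r !subr0 !mul0r subr0 expr0n eqxx.
Qed.

(** Dividing by a coefficient of least value makes all coefficients integral and
one of them equal to 1. *)
Lemma primitive_poly (p : {poly K}) : p != 0 ->
  exists2 k, k != 0 & exists2 p1 : {poly O}, p = k *: map_poly val p1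
    & map_poly rho p1 != 0.
Proof.
move=> p0; have [|k k0 [wk [x xp kx]]] := @scale_to_primitive p.
  apply/hasP; exists (lead_coef p); rewrite ?lead_coef_eq0 // mem_nth //.
  by rewrite prednK ?size_poly_gt0.
have wkp i : vge w 0 (k^-1 *: p)`_i.
  rewrite coefZ; have [ip|pi] := ltnP i (size p); first exact: wk (mem_nth 0 ip).
  by rewrite nth_default // mulr0 vge0.
exists k => //; exists (map_poly to_valring (k^-1 *: p)).
  by rewrite map_to_valring // scalerA divff // scale1r.
apply/eqP => e0; have := oner_neq0 (residue w).
rewrite -(rmorph1 rho) => /eqP; apply.
have -> : 1 = to_valring (k^-1 *: p)`_(index x p).
  by apply: val_inj; rewrite to_valringK // coefZ nth_index // kx rmorph1.
by rewrite -coef_map_id0 ?to_valring0 // -coef_map e0 coef0.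
Qed.

Lemma primitive_quadpair (q0 : quadpair K) : qres q0 != 0 ->
  exists2 k, k != 0 & exists2 q1 : quadpair O,
    q0 = qmap ( *%R k) (qmap val q1)
    & (qnum (qmap rho q1) != 0) || (qden (qmap rho q1) != 0).
Proof.
case: q0 => a2 a1 a0 b2 b1 b0 r0.
have [|k k0 [wk [x xq kx]]] := @scale_to_primitive [:: a2; a1; a0; b2; b1; b0].
  by apply/hasP; case/orP: (qres_lead r0) => /= nz; [exists a2|exists b2];
     rewrite ?inE ?eqxx ?orbT.
exists k => //; set q1 := qmap to_valring (qmap ( *%R k^-1)
  (QuadPair a2 a1 a0 b2 b1 b0)); exists q1.
  by rewrite /q1 /=; congr QuadPair;
    rewrite to_valringK ?mulVKf // wk // !inE eqxx ?orbT.
rewrite -negb_and; apply/negP => /andP[].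
have quad0 (a b c : residue w) : quad a b c == 0 -> [/\ a = 0, b = 0 & c = 0].
  by rewrite quad_eq0 => /and3P[/eqP ? /eqP ? /eqP ?].
move=> /quad0[n2 n1 n0] /quad0[d2 d1 d0].
have := oner_neq0 (residue w); rewrite -(rmorph1 rho) => /eqP; apply.
have -> : 1 = to_valring (k^-1 * x).
  by apply: val_inj; rewrite to_valringK ?wk // kx rmorph1.
move: xq; rewrite !inE => /or4P[/eqP->|/eqP->|/eqP->|/or3P[/eqP->|/eqP->|/eqP->]].
- exact: n2.
- exact: n1.
- exact: n0.
- exact: d2.
- exact: d1.
- exact: d0.
Qed.

(** The model (F, G) may have a common factor and coefficients of high degree,
so it is compared with a primitive pair q1 in lowest terms: F and G are t H1
times the two forms of q1, with H1 primitive. By Gauss's lemma t is integral, so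
the reduced map is the one defined by the reduction of q1; having degree 2, it
has nonzero resultant. *)
Lemma good_reduction_normal psi : rdeg psi = 2%N -> good_reduction w psi ->
  exists2 q : quadpair O, psi = qratfun (qmap val q) & rho (qres q) != 0.
Proof.
move=> d2 [F [G [G0 eFG _ dred]]].
have [q0 eq0 r0] := rdeg2_qratfun d2.
have [c c0 [en ed]] := qratfun_lowest r0; rewrite -eq0 in en ed.
have r'0 : qres (qmap ( *%R c) q0) != 0 by rewrite qres_scale mulf_neq0 ?expf_neq0.
have [k k0 [q1 eq1 prim1]] := primitive_quadpair r'0.
have GK0 : map_poly val G != 0 :> {poly K}.
  by rewrite -(rmorph0 (map_poly (val : O -> K))) (inj_eq val_map_inj).
have [H] := rnum_rden_frac (map_poly val F) GK0.
rewrite -eFG en ed eq1 qnum_scale qden_scale => eF eG.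
have H0 : H != 0 by apply: contra_neq GK0; rewrite eG => ->; rewrite mul0r.
have [h h0 [H1 eH H1r]] := primitive_poly H0.
pose t := h * k; have t0 : t != 0 by rewrite mulf_neq0.
have {}eF : map_poly val F = t *: map_poly val (H1 * qnum q1).
  by rewrite eF eH map_polyM qnum_map -scalerAl -scalerAr scalerA.
have {}eG : map_poly val G = t *: map_poly val (H1 * qden q1).
  by rewrite eG eH map_polyM qden_map -scalerAl -scalerAr scalerA.
(* If t^-1 were in the maximal ideal, H1 times q1 would reduce to 0, although
   neither H1 nor q1 does. *)
have wt : vge w 0 t.
  apply: contraT; rewrite /vge (negPf t0) -ltNge => wt.
  have wtV : vge w 1 t^-1.
    by rewrite /vge invr_eq0 (negPf t0) dvalV // -gtz0_ge1 ?oppr_gt0.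
  have wtV0 : vge w 0 t^-1.
    by move: wtV; rewrite /vge invr_eq0 (negPf t0); exact: le_trans.
  have rt : rho (to_valring t^-1) = 0.
    by apply/eqP; rewrite residue_map_eq0 to_valringK.
  have red (P Q : {poly O}) :
      map_poly val P = t *: map_poly val Q -> map_poly rho Q = 0.
    move=> e; have -> : Q = to_valring t^-1 *: P.
      apply: val_map_inj.
      by rewrite map_val_to_valringZ // e scalerA mulVf // scale1r.
    by rewrite map_rhoZ rt scale0r.
  have cancel (p : {poly residue w}) : map_poly rho H1 * p = 0 -> p == 0.
    by move/eqP; rewrite mulf_eq0 (negPf H1r).
  move: (red _ _ eF) (red _ _ eG); rewrite !map_polyM qnum_map qden_map.
  move=> /cancel n0 /cancel d0.
  by case/orP: prim1 => /negP nz; case: nz; [exact: n0|exact: d0].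
have FE : F = to_valring t *: (H1 * qnum q1).
  by apply: val_map_inj; rewrite (map_val_to_valringZ _ wt); exact: eF.
have GE : G = to_valring t *: (H1 * qden q1).
  by apply: val_map_inj; rewrite (map_val_to_valringZ _ wt); exact: eG.
(* If G reduced to 0, so would the quotient, which is then of degree 0. *)
have Gr0 : map_poly rho G != 0.
  apply/eqP => Gr; rewrite Gr rmorph0 invr0 mulr0 d2 in dred.
  exact: (rdeg0_neq2 dred).
have FrE := map_scaled_qnum rho (to_valring t) H1 q1; rewrite -FE in FrE.
have GrE := map_scaled_qden rho (to_valring t) H1 q1; rewrite -GE in GrE.
rewrite GrE mulf_eq0 in Gr0; case/norP: Gr0 => D0 M0.
rewrite FrE GrE (frac_mulK _ _ M0) d2 in dred.
exists q1; last by rewrite -qres_map; exact: (rdeg2_qres D0 dred).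
by rewrite eq0 -(qratfun_scale q0 c0) eq1 qratfun_scale.
Qed.

End GoodReduction.

(** * Integral normal forms *)

Lemma rdeg_rmap (K L : fieldType) (h : {rmorphism K -> L}) (phi : ratfun K) :
  rdeg (rmap h phi) = rdeg phi.
Proof.
have cop : coprimep (map_poly h (rnum phi)) (map_poly h (rden phi)).
  by rewrite coprimep_map coprime_rnum_rden.
have G0 : map_poly h (rden phi) != 0 by rewrite map_poly_eq0 rden_neq0.
have [c c0 [eF eG]] := rnum_rden_coprime G0 cop; rewrite -/(rmap h phi) in eF eG.
by rewrite /rdeg -(size_scale (rnum (rmap h phi)) c0) -(size_scale (rden _) c0)
  -eF -eG !size_map_poly.
Qed.

(** When oo is fixed, its multiplier is l = b1 / a2. This is the relation l^3 -
sigma1 l^2 + sigma2 l - sigma3 = 0 with sigma3 = sigma1 - 2, cleared of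
denominators. *)
Lemma multiplier_cubic_oo (R : comNzRingType) (q : quadpair R) : qb2 q = 0 ->
  qb1 q ^+ 3 * qres q - sigma1num q * qb1 q ^+ 2 * qa2 q
    + sigma2num q * qb1 q * qa2 q ^+ 2
    - (sigma1num q - 2 * qres q) * qa2 q ^+ 3 = 0.
Proof. by case: q => a2 a1 a0 b2 b1 b0 /= ->; ring. Qed.

Section NormalFormIntegral.
Variables (C : closedFieldType) (B : C -> Prop) (vB : valuation_subring B).
Let sB : subringP B := proj1 vB.
Let B1 := subring1 sB.
Let B0 := subring0 sB.

(** The multiplier l at a fixed point decides which normal form has unit
resultant: l^2 is a unit when l is, and 1 - l m is one when l is not. The
remaining coefficient is integral over the invariants in both cases. *)
Theorem integral_normal_form (q : quadpair C) : qres q != 0 ->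
  B (sigma1num q / qres q) -> B (sigma2num q / qres q) ->
  exists q', [/\ qconj q q', qall B q' & units_of B (qres q')].
Proof.
set s1 := sigma1num q / _; set s2 := sigma2num q / _ => r0 Bs1 Bs2.
have [q1 c1 b20] := qconj_fix_oo r0.
have [r10 e1 e2] := qconj_sigma c1 r0; rewrite -/s1 in e1; rewrite -/s2 in e2.
have a20 : qa2 q1 != 0 by have := qres_lead r10; rewrite b20 eqxx orbF.
set l := qb1 q1 / qa2 q1.
have Bs12 : B (s1 - 2) by apply: (subringB sB) => //; exact: (subring_nat sB).
have Bl : B l.
  apply: (@valuation_cubic _ _ vB l s1 (- s2) (s1 - 2)) => //.
    exact: (subringN sB).
  have e := multiplier_cubic_oo b20.
  have r1a : qres q1 * qa2 q1 ^+ 3 != 0 by rewrite mulf_neq0 ?expf_neq0.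
  apply: (mulfI r1a); rewrite -e1 -e2 /l.
  apply/eqP; rewrite -subr_eq0 -e; apply/eqP.
  by field; rewrite r10 a20.
have [ul|nl] := pselect (units_of B l).
  have [l0 _ BlV] := ul.
  have b10 : qb1 q1 != 0 by apply: contraNneq l0 => b10; rewrite /l b10 mul0r.
  have [t c2] := normal_form_unit r10 b20 b10; rewrite -/l in c2.
  have c := qconj_trans c1 c2.
  have [r20 + _] := qconj_sigma c r0; rewrite -/s1 => e.
  have rE : qres (QuadPair 1 t 1 0 l 0) = l ^+ 2 by rewrite /qres; ring.
  exists (QuadPair 1 t 1 0 l 0); split=> //; last by rewrite rE; exact: unitsX.
  (* The formula for sigma1 on this normal form, solved for t^2. *)
  split; split=> //; apply: (valuation_sqrt vB (c0 := l ^+ 2 - (2 + s1) * l + 4)).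
    apply: (subringD sB) _ (subring_nat sB 4).
    apply: (subringB sB); first exact: (subringX sB).
    apply: (subringM sB) => //; apply: (subringD sB) => //.
    exact: (subring_nat sB).
  by rewrite -e rE /sigma1num; field.
have Ml : nonunits_of B l by apply: contrapT => h; apply: nl; exact: not_nonunits.
have l1 : l != 1.
  by apply: contra_not_neq (units_not_nonunits (units1 vB)) => <-.
have ba : qb1 q1 != qa2 q1.
  by apply: contraNneq l1 => e; rewrite /l e divff.
have [m c2] := normal_form_nonunit r10 b20 ba; rewrite -/l in c2.
have c := qconj_trans c1 c2; have [r20 em1 em2] := qconj_sigma c r0.
rewrite -/s1 in em1; rewrite -/s2 in em2.
have rE : qres (QuadPair 1 m 0 0 l 1) = 1 - l * m by rewrite /qres; ring.
(* The multiplier at 0 is m; it satisfies the same cubic as l. *)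
have Bm : B m.
  apply: (@valuation_cubic _ _ vB m s1 (- s2) (s1 - 2)) => //.
    exact: (subringN sB).
  by rewrite -em1 -em2 rE /sigma1num /sigma2num; field; rewrite -rE.
exists (QuadPair 1 m 0 0 l 1); split=> //.
by rewrite rE; apply: (units1B vB); exact: (nonunitsM vB).
Qed.

End NormalFormIntegral.

(** * The criterion *)

Lemma vge_extends (K : fieldType) (v : dvaluation K) (L : fieldExtType K)
    (w : dvaluation L) (x : K) : dval_extends v w ->
  vge w 0 (x%:A) = vge v 0 x.
Proof.
move=> [e e0 we]; rewrite /vge scaler_eq0 oner_eq0 orbF.
by have [//|x0] := eqVneq x 0; rewrite we // pmulrn_lge0.
Qed.

Section Main.
Variables (K : fieldType) (v : dvaluation K) (C : closedFieldType).
Variables (iota : {rmorphism K -> C}) (phi : ratfun K).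
Hypothesis phi_deg2 : rdeg phi = 2%N.

Lemma sigma_rmap_qratfun (q : quadpair K) : qres q != 0 ->
  sigma1 (rmap iota (qratfun q)) = iota (sigma1num q / qres q) /\
  sigma2 (rmap iota (qratfun q)) = iota (sigma2num q / qres q).
Proof.
move=> r0; rewrite rmap_qratfun //.
have [|-> ->] := @sigma_qratfun _ (qmap iota q).
  by rewrite qres_map fmorph_eq0.
by rewrite sigma1num_map sigma2num_map qres_map !fmorph_div.
Qed.

(** The quotients defining the invariants have unit denominator for an integral
model of the good conjugate. Their values lie in K, where integrality for w is
integrality for v. *)
Lemma potential_good_reduction_integral :
  potential_good_reduction v iota phi -> integral_point v iota phi.
Proof.
move=> [L [w [j [A [psi [wv jK uA eA good]]]]]].
have [q eq r0] := rdeg2_qratfun phi_deg2.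
have rC0 : qres (qmap iota q) != 0 by rewrite qres_map fmorph_eq0.
pose q2 := qsubst (qmap iota q) (A 0 0) (A 0 1) (A 1 0) (A 1 1).
have r20 : qres q2 != 0 by rewrite qres_subst mulf_neq0 // expf_neq0 // det2_neq0.
have e2 : rmap j psi = qratfun q2 by rewrite -eA eq rmap_qratfun // rconj_qratfun.
have d2 : rdeg psi = 2%N by rewrite -(rdeg_rmap j) e2 rdeg_qratfun.
have [q3 e3 rr3] := good_reduction_normal d2 good.
have [v30 w3V] := residue_neq0 rr3.
have r30 : qres (qmap val q3) != 0 by rewrite qres_map.
have [s1 s2] := sigma_rmap_qratfun r0; rewrite -eq in s1 s2.
have c2 : qconj (qmap iota q) q2 by apply: qconj_subst; exact: det2_neq0.
have [_ i1 i2] := qconj_sigma c2 rC0.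
have [t1 t2] := sigma_qratfun r20.
rewrite -e2 e3 rmap_qratfun // in t1 t2.
have rj30 : qres (qmap j (qmap val q3)) != 0 by rewrite qres_map fmorph_eq0.
have [u1 u2] := sigma_qratfun rj30.
have descend (x : K) (y : L) : vge w 0 y -> iota x = j y -> vge v 0 x.
  move=> wy exy; rewrite -(vge_extends x wv); suff -> : x%:A = y by [].
  by apply: (fmorph_inj j); rewrite jK.
have frac_int (x : valring w) : vge w 0 (val x / val (qres q3)).
  exact: (@vgeM _ w 0 0 _ _ (valP x) w3V).
have int1 : vge v 0 (sigma1num q / qres q).
  apply: (descend _ _ (frac_int (sigma1num q3))).
  by rewrite !fmorph_div -!sigma1num_map -!qres_map -i1 -t1 u1.
have int2 : vge v 0 (sigma2num q / qres q).
  apply: (descend _ _ (frac_int (sigma2num q3))).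
  by rewrite !fmorph_div -!sigma2num_map -!qres_map -i2 -t2 u2.
by exists (ValRing int1), (ValRing int2).
Qed.

(** If x in K is not integral and p is a uniformizer, then x^-1 / p is integral,
so a ring containing x and the integers contains p^-1. *)
Lemma exists_ambient_valuation_subring : exists B : C -> Prop,
  valuation_subring B /\ forall x, B (iota x) <-> vge v 0 x.
Proof.
have [p p0 vp] := dval_onto v 1.
have p'0 : iota p != 0 by rewrite fmorph_eq0.
pose O (y : C) := exists2 x, vge v 0 x & y = iota x.
have sO : subringP O.
  split; first by exists 1; rewrite ?rmorph1 // /vge dval1 lexx orbT.
    move=> _ _ [x vx ->] [y vy ->]; exists (x - y); last by rewrite rmorphB.
    by rewrite vgeD ?vgeN.
  move=> _ _ [x vx ->] [y vy ->]; exists (x * y); last by rewrite rmorphM.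
  by rewrite -[0]addr0 vgeM.
have Op : O (iota p) by exists p; rewrite // /vge vp orbT.
have OpV : ~ O (iota p)^-1.
  move=> [x vx]; rewrite -fmorphV => /fmorph_inj ex; move: vx; rewrite -ex.
  by rewrite /vge invr_eq0 (negPf p0) dvalV // vp.
have [B [vB OB BpV]] := exists_valuation_subring sO p'0 Op OpV.
have sB := proj1 vB; exists B; split=> // x.
split=> [Bx|vx]; last by apply: OB; exists x.
apply: contraT; rewrite /vge negb_or => /andP[x0]; rewrite -ltNge => vx.
case: BpV; have -> : (iota p)^-1 = iota x * iota (x^-1 / p).
  by rewrite -rmorphM mulrA divff // mul1r fmorphV.
apply: (subringM sB) => //; apply: OB; exists (x^-1 / p) => //.
rewrite /vge dvalM ?invr_eq0 // !dvalV // vp; apply/orP; right.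
by rewrite subr_ge0 -gtz0_ge1 oppr_gt0.
Qed.

Hypothesis C_algebraic : forall x : C, algebraicOver iota x.

(** The valuation subring B of C is fixed before the finite extension L, so that
the normal form can be chosen by its position relative to B; L is then generated
by its coefficients, and B cuts out a discrete valuation on L. *)
Lemma integral_potential_good_reduction :
  integral_point v iota phi -> potential_good_reduction v iota phi.
Proof.
move=> [s1 [s2 [e1 e2]]].
have [q eq r0] := rdeg2_qratfun phi_deg2.
have rC0 : qres (qmap iota q) != 0 by rewrite qres_map fmorph_eq0.
have [B [vB BK]] := exists_ambient_valuation_subring.
have [f1 f2] := sigma_qratfun rC0; rewrite -rmap_qratfun // -eq e1 e2 in f1 f2.
have [||q' [cq Bq' Uq']] := integral_normal_form vB rC0.
- by rewrite -f1; apply/BK; exact: valP.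
- by rewrite -f2; apply/BK; exact: valP.
have [A uA eA] := qconj_rconj cq rC0.
have [L [j [jK jq]]] : exists (L : fieldExtType K) (j : {rmorphism L -> C}),
    (forall x : K, j x%:A = iota x) /\ exists q1, qmap j q1 = q'.
  case: q' {cq Bq' Uq' eA} => a2 a1 a0 b2 b1 b0.
  have [|L [j [jK js]]] :=
    @exists_finite_subextension K C iota [:: a2; a1; a0; b2; b1; b0].
    by move=> x _; exact: C_algebraic.
  exists L, j; split=> //.
  have [x2 e2'] : exists l, j l = a2 by apply: js; rewrite !inE eqxx ?orbT.
  have [x1 e1'] : exists l, j l = a1 by apply: js; rewrite !inE eqxx ?orbT.
  have [x0 e0'] : exists l, j l = a0 by apply: js; rewrite !inE eqxx ?orbT.
  have [y2 g2] : exists l, j l = b2 by apply: js; rewrite !inE eqxx ?orbT.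
  have [y1 g1] : exists l, j l = b1 by apply: js; rewrite !inE eqxx ?orbT.
  have [y0 g0] : exists l, j l = b0 by apply: js; rewrite !inE eqxx ?orbT.
  by exists (QuadPair x2 x1 x0 y2 y1 y0); rewrite /= e2' e1' e0' g2 g1 g0.
case: jq => q1 jq1; subst q'.
pose R (x : L) := B (j x).
have vR : valuation_subring R.
  have sB := proj1 vB; split; first split.
  - by rewrite /R rmorph1; exact: (subring1 sB).
  - by move=> x y Rx Ry; rewrite /R rmorphB; exact: (subringB sB).
  - by move=> x y Rx Ry; rewrite /R rmorphM; exact: (subringM sB).
  - by move=> x; rewrite /R fmorphV; exact: (valuation_total vB).
have RK (x : K) : R x%:A <-> vge v 0 x by rewrite /R jK.
have [w wv wR] := extend_dvaluation vR RK.
have q1E : qmap val (qmap (to_valring w) q1) = q1.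
  rewrite qmap_comp; apply: (qmap_id_on (P := fun x => vge w 0 x)).
    case: q1 Bq' {cq Uq' eA} => a b c d e f [[? ? ?] [? ? ?]].
    by split; split; apply/wR.
  by move=> x wx /=; rewrite to_valringK.
exists L, w, j, A, (qratfun q1); split=> //.
  rewrite eq rmap_qratfun // eA rmap_qratfun //.
  by case: Uq'; rewrite qres_map fmorph_eq0.
rewrite -{1}q1E; apply: good_reduction_qratfun.
have vE : val (qres (qmap (to_valring w) q1)) = qres q1 by rewrite -qres_map q1E.
case: Uq'; rewrite qres_map fmorph_eq0 -fmorphV => r10 _ rV.
by apply: residue_neq0_unit; rewrite vE //; apply/wR.
Qed.

End Main.

Theorem theorem3p2 (K : fieldType) (v : dvaluation K)
    (C : closedFieldType) (iota : {rmorphism K -> C})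
    (phi : ratfun K)
    (v_complete : complete_dvaluation v)
    (C_algebraic : forall x : C, algebraicOver iota x)
    (phi_deg2 : rdeg phi = 2%N) :
  potential_good_reduction v iota phi <-> integral_point v iota phi.
Proof.
split; first exact: potential_good_reduction_integral.
exact: integral_potential_good_reduction.
Qed.
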